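(* Let $G$ be a graph with $n$ vertices, $m$ edges and degree sequence $(d(v_1),\dots,d(v_n))$, and let $\alpha\in[0,1]$. For a hook partition $(k,1^{n-k})$ of $n$ write $$\operatorname{Imm}_{(k,1^{n-k})}(xI-A_\alpha(G))=\sum_{r=0}^n(-1)^r c_r\,x^{n-r},\qquad c_r=c_{(k,1^{n-k}),r}(A_\alpha(G)).$$ Then $$c_0=\binom{n-1}{k-1},\qquad c_1=2m\alpha\binom{n-1}{k-1},$$ $$c_2=\alpha^2F_2(G)\binom{n-1}{k-1}+\frac{(2k-n-1)m(1-\alpha)^2}{k-1}\binom{n-2}{k-2}\quad(n\ge3),$$ $$c_3=\alpha^3F_3(G)\binom{n-1}{k-1}+\frac{(2k-n-1)\alpha(1-\alpha)^2\mathcal{M}_3^1(G)}{k-1}\binom{n-2}{k-2}+2|\mathscr{C}_3(G)|(1-\alpha)^3\left[\binom{n-4}{k-4}-\binom{n-4}{k-1}\right]\quad(n\ge4),$$ $$\begin{aligned}c_4={}&\alpha^4F_4(G)\binom{n-1}{k-1}+\frac{(2k-n-1)\alpha^2(1-\alpha)^2\mathcal{M}_4^1(G)}{k-1}\binom{n-2}{k-2}+\alpha(1-\alpha)^3\mathcal{C}_4^3(G)\left[\binom{n-4}{k-4}-\binom{n-4}{k-1}\right]\\&+2|\mathscr{C}_4(G)|(1-\alpha)^4\left[\binom{n-5}{k-5}-\binom{n-5}{k-1}\right]\\&+\left[\binom m2-\sum_{i=1}^n\binom{d(v_i)}2\right]\left[\binom{n-5}{k-5}-2\binom{n-5}{k-3}+\binom{n-5}{k-1}\right](1-\alpha)^4\quad(n\ge5),\end{aligned}$$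 and $$\begin{aligned}c_5={}&\alpha^5F_5(G)\binom{n-1}{k-1}+\frac{(2k-n-1)\alpha^3(1-\alpha)^2\mathcal{M}_5^1(G)}{k-1}\binom{n-2}{k-2}+2\alpha^2(1-\alpha)^3\mathcal{C}_5^3(G)\left[\binom{n-4}{k-4}+\binom{n-4}{k-1}\right]\\&+2\alpha(1-\alpha)^4\mathcal{C}_5^4(G)\left[\binom{n-5}{k-5}-\binom{n-5}{k-1}\right]+\alpha(1-\alpha)^4\mathcal{M}_5^2(G)\left[\binom{n-5}{k-5}-2\binom{n-5}{k-3}+\binom{n-5}{k-1}\right]\\&+2|\mathscr{C}_5(G)|(1-\alpha)^5\left[\binom{n-6}{k-6}-\binom{n-6}{k-1}\right]\\&+\sum_{j=1}^{|\mathscr{C}_3(G)|}2\big(m+3-\mathscr{T}_j(G)\big)(1-\alpha)^5\left[\binom{n-6}{k-6}+\binom{n-6}{k-3}-\binom{n-6}{k-4}-\binom{n-6}{k-1}\right]\quad(n\ge6).\end{aligned}$$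
   Context: Graphs are finite and simple. $A_\alpha(G)=\alpha D(G)+(1-\alpha)A(G)$, where $D(G)$ is the diagonal degree matrix and $A(G)$ the adjacency matrix of $G$, with vertices $v_1,\dots,v_n$ and degrees $d(v_i)$. For a partition $\lambda$ of $n$, $\chi_\lambda$ is the irreducible character of $\mathcal{S}_n$ indexed by $\lambda$ (so $(n)$ gives the trivial and $(1^n)$ the sign character), and $\operatorname{Imm}_\lambda(M)=\sum_{\sigma\in\mathcal{S}_n}\chi_\lambda(\sigma)\prod_{i=1}^n m_{i\sigma(i)}$ for an $n\times n$ matrix $M=[m_{ij}]$; the coefficients $c_{\lambda,r}(M)$ are defined by $\operatorname{Imm}_\lambda(xI_n-M)=\sum_{r=0}^n(-1)^r c_{\lambda,r}(M)x^{n-r}$. $F_r$ is the $r$th elementary symmetric function and $F_r(G)=F_r(d(v_1),\dots,d(v_n))$. $\mathscr{C}_l(G)$ is the set of cycles of length $l$ in $G$ and $\mathscr{M}_l(G)$ the set of $l$-matchings (sets of $l$ pairwise disjoint edges). For a cycle $C$ (resp. matching $\mathfrak{M}$), $\mathfrak{D}_C(G)$ (resp. $\mathfrak{D}_{\mathfrak{M}}(G)$) is the sequence of degrees (in $G$) of the vertices of $G$ not on $C$ (resp. not covered by $\mathfrak{M}$). Put $\mathcal{C}_r^l(G)=\sum_{C\in\mathscr{C}_l(G)}F_{r-l}(\mathfrak{D}_C(G))$ and $\mathcal{M}_r^l(G)=\sum_{\mathfrak{M}\in\mathscr{M}_l(G)}F_{r-2l}(\mathfrak{D}_{\mathfrak{M}}(G))$.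 The triangles in $\mathscr{C}_3(G)$ are numbered, and $\mathscr{T}_j(G)$ is the sum of the degrees of the three vertices of the $j$th triangle. Binomial coefficients follow the usual convention ($\binom ab=0$ if $b<0$ or $b>a\ge0$).
   Formalization: As printed false: in c_3, in the C_4^3 term of c_4 and in the |C_5(G)| term of c_5 the minus in the bracket is replaced by plus; a factor 2 is added to the C_4^3 term of c_4; for k=1 the undefined binom(n-2,k-2)/(k-1) is read as 1/(n-1). *)

(* Defs.v *)
From HB Require Import structures.
From mathcomp Require Import all_boot all_order all_algebra all_fingroup.
From mathcomp Require Import all_solvable all_field all_character.

Set Implicit Arguments.
Unset Strict Implicit.
Unset Printing Implicit Defensive.

Import Order.TTheory GRing.Theory Num.Theory.

(* Partitions are weakly decreasing sequences of positive integers. *)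
Definition conj_part (la : seq nat) : seq nat :=
  mkseq (fun j => count (fun x => j < x) la) (head 0 la).

Definition hook_part (n k : nat) : seq nat := k :: nseq (n - k) 1.

(* {0, ..., n-1} is cut into consecutive blocks of sizes la_1, la_2, ...;      *)
(* [reshape_index la i] is the number of the block containing i.               *)
Definition young_set (n : nat) (la : seq nat) : {set 'S_n} :=
  [set s : 'S_n |
    [forall i : 'I_n, reshape_index la (s i) == reshape_index la i]].

Lemma young_group_set (n : nat) (la : seq nat) : group_set (young_set n la).
Proof.
apply/group_setP; split=> [|s t].
  by rewrite inE; apply/forallP=> i; rewrite perm1.
rewrite !inE => /forallP Hs /forallP Ht; apply/forallP=> i.
by rewrite permM (eqP (Ht _)) (eqP (Hs _)).
Qed.

Canonical young_group (n : nat) (la : seq nat) : {group 'S_n} :=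
  Group (young_group_set n la).

Section SymmetricCharacters.

Local Open Scope ring_scope.

Lemma sgn_is_class_fun (n : nat) :
  is_class_fun <<[set: 'S_n]>>%g [ffun s : 'S_n => (-1) ^+ (s : bool)].
Proof.
apply: intro_class_fun => [s t _ _|s]; first by rewrite odd_permJ.
by rewrite mem_gen ?inE.
Qed.

Definition sgn_cf (n : nat) : 'CF([set: 'S_n]) := Cfun 0 (sgn_is_class_fun n).

(* chi_la is the unique common irreducible constituent of the trivial          *)
(* character of the Young subgroup S_la and of the sign character of S_la',    *)
(* both induced to S_n (the definition of James and Kerber), so that (n) gives *)
(* the trivial character and (1^n) the sign character.                         *)
Definition sym_chi (n : nat) (la : seq nat) : 'CF([set: 'S_n]) :=
  let triv_ind := 'Ind[[set: 'S_n], young_group n la] 1 in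
  let sgn_ind := 'Ind[[set: 'S_n], young_group n (conj_part la)]
                   ('Res[young_group n (conj_part la)] (sgn_cf n)) in
  if [pick i | (i \in irr_constt triv_ind) && (i \in irr_constt sgn_ind)]
    is Some i then 'chi_i else 0.

(* The values of characters of S_n are rational integers; taking the floor     *)
(* only moves them from algC to int, and thence into any ring.                 *)
Definition sym_chi_int (n : nat) (la : seq nat) (s : 'S_n) : int :=
  Num.floor (sym_chi n la s).

Definition immanant (R : comNzRingType) (n : nat) (la : seq nat)
    (M : 'M[R]_n) : R :=
  \sum_(s : 'S_n) (sym_chi_int la s)%:~R * \prod_(i < n) M i (s i).

Definition imm_poly (R : comNzRingType) (n : nat) (la : seq nat)
    (M : 'M[R]_n) : {poly R} :=
  immanant la (char_poly_mx M).

(* Meaningful for r <= n only. *)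
Definition imm_coef (R : comNzRingType) (n : nat) (la : seq nat)
    (M : 'M[R]_n) (r : nat) : R :=
  (-1) ^+ r * (imm_poly la M)`_(n - r).

End SymmetricCharacters.

(* A graph on the vertices {0, ..., n-1} is given by its adjacency relation.   *)
Section Graphs.

Variables (n : nat) (e : rel 'I_n).

Definition deg (i : 'I_n) : nat := #|[set j | e i j]|.

Definition edges : {set {set 'I_n}} :=
  [set E : {set 'I_n} | [exists i, exists j, e i j && (E == [set i; j])]].

(* Cycles and matchings are given by their edge sets, so that the set of       *)
(* vertices which they cover is [cover C].                                     *)
Definition cycle_edges (p : seq 'I_n) : {set {set 'I_n}} :=
  [set [set x; next p x] | x in p].

Definition cycles (l : nat) : {set {set {set 'I_n}}} :=
  [set cycle_edges p | p : l.-tuple 'I_n & (2 < l) && ucycleb e p].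

Definition matchings (l : nat) : {set {set {set 'I_n}}} :=
  [set M : {set {set 'I_n}} | [&& M \subset edges, trivIset M & #|M| == l]].

Definition elem_sym (r : nat) (s : seq nat) : nat :=
  \sum_(A : {set 'I_(size s)} | #|A| == r) \prod_(i in A) nth 0 s i.

Definition deg_seq : seq nat := [seq deg i | i <- enum 'I_n].

Definition deg_seq_off (C : {set {set 'I_n}}) : seq nat :=
  [seq deg i | i <- enum (~: cover C)].

Definition Fdeg (r : nat) : nat := elem_sym r deg_seq.

(* Used only when l <= r. *)
Definition cycle_sum (r l : nat) : nat :=
  \sum_(C in cycles l) elem_sym (r - l) (deg_seq_off C).

(* Used only when 2 l <= r. *)
Definition matching_sum (r l : nat) : nat :=
  \sum_(M in matchings l) elem_sym (r - 2 * l) (deg_seq_off M).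

Definition triangle_deg (C : {set {set 'I_n}}) : nat :=
  \sum_(i in cover C) deg i.

Local Open Scope ring_scope.

Definition deg_mx (R : comNzRingType) : 'M[R]_n :=
  diag_mx (\row_i (deg i)%:R).

Definition adj_mx (R : comNzRingType) : 'M[R]_n :=
  \matrix_(i, j) (e i j)%:R.

Definition Aalpha (R : comNzRingType) (alpha : R) : 'M[R]_n :=
  alpha *: deg_mx R + (1 - alpha) *: adj_mx R.

End Graphs.

(* The value of chi_(k,1^(n-k)) at a permutation of cycle type (l_1, l_2, ...) *)
(* is the coefficient of y^(n-k) in                                            *)
(*   (1 + y)^-1 * (1 - (-y)^l_1) * (1 - (-y)^l_2) * ...                        *)
(* At a 3-cycle this is binom(n-4, k-4) + binom(n-4, k-1), and at a 5-cycle    *)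
(* binom(n-6, k-6) + binom(n-6, k-1). These values are used in the theorem     *)
(* wherever such cycles occur; the source prints some of them with a minus     *)
(* sign (in c_3, c_4 and c_5), and omits the factor 2, for the two             *)
(* orientations of a cycle, in the triangle term of c_4; as printed, c_3, c_4  *)
(* and c_5 are false (e.g. c_3 for a triangle with two isolated vertices,      *)
(* k = 2 and alpha = 0, is 2 and not -2).                                      *)
Section Coefficients.

Local Open Scope ring_scope.

(* The binomial coefficient with a possibly negative lower argument. *)
Definition binz (R : nzRingType) (a : nat) (b : int) : R :=
  if b is Posz b' then 'C(a, b')%:R else 0.

(* (k-1)^-1 * binom(n-2, k-2). For k = 1 this quotient is 0/0, and it is given *)
(* the value (n-1)^-1 dictated by the absorption identity                      *)
(* (k-1)^-1 * binom(n-2, k-2) = (n-1)^-1 * binom(n-1, k-1), valid for k > 1.   *)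
Definition binz_quot (R : fieldType) (n k : nat) : R :=
  if k == 1%N then (n%:R - 1)^-1
  else binz R (n - 2) (k%:Z - 2) / (k%:R - 1).

End Coefficients.

(* Main.v *)
Require Import Defs.
From HB Require Import structures.
From mathcomp Require Import all_boot all_order all_algebra all_fingroup.
From mathcomp Require Import all_solvable all_field all_character.
From mathcomp Require Import zify ring.

Set Implicit Arguments.
Unset Strict Implicit.
Unset Printing Implicit Defensive.

Import Order.TTheory GRing.Theory Num.Theory.
Local Open Scope ring_scope.

(** Expand the immanant over permutations.  In the product attached to [s], a
    fixed point [i] of [s] contributes [x - alpha d(i)] and a moved point [i]
    contributes [-(1 - alpha)] if [i] and [s i] are adjacent and [0] otherwise.
    Hence (lemma [imm_coefE]) [c_r] is the sum, over the permutations [s] which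
    move at most [r] points, each of them along an edge, of
      chi(s) (1 - alpha)^p alpha^(r - p) F_(r - p)(degrees of the fixed points),
    where [p] is the number of moved points.

    For [p <= 5] such an [s] is the identity ([p = 0]), the exchange of the ends
    of an edge (2), an oriented triangle (3), an oriented 4-cycle or the exchange
    along two disjoint edges (4), an oriented 5-cycle or the product of an
    oriented triangle and a disjoint edge (5).  Mapping [s] to the set of edges
    {i, s i} makes involutions correspond to matchings ([sum_graph_invol]), and
    is two to one from cyclic permutations of length at least 3 onto the cycles
    of the graph ([sum_graph_cycles]).  The mixed type is counted by
    [card_graph_32], and the edges which avoid a triangle by [triangle_edges].

    It remains to evaluate the hook characters.  Let [cycle_poly s] be the
    product of 1 - (-X)^l over the cycle lengths [l] of [s]; its coefficient of
    X^i is the value at [s] of the character [ext_char] of the i-th exterior power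
    of the permutation representation, which is induced from the sign of the first
    factor of S_i x S_(n-i).
    The scalar products of these characters are 2 on the diagonal (1 at the
    ends), 1 next to it, and 0 elsewhere.  So the alternating sums [hook_chi j],
    whose values at [s] are the coefficients of [cycle_poly s] divided by 1 + X,
    have norm 1 and are irreducible.  [hook_chi (n - k)] is a constituent both of the trivial
    character induced from S_k and of the sign induced from S_(n-k+1), because it
    occurs in two consecutive exterior powers; and these two induced characters
    have scalar product at most 1 ([dot_Ind_Sym_le1]), so that they share no
    other constituent.  Therefore [hook_chi (n - k)] is the character of the hook
    (k, 1^(n-k)), and its values at the seven types above are combinations
    of binomial coefficients. *)

(** * The cycle polynomial of a permutation *)

Section CyclePoly.
Local Open Scope group_scope.
Local Open Scope ring_scope.
Variable T : finType.
Implicit Types (s p : {perm T}) (A c : {set T}) (x : T).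

Lemma porbits_partition s : partition (porbits s) [set: T].
Proof.
have -> : porbits s = orbit 'P <[s]> @: [set: T].
  apply/setP=> c; apply/imsetP/imsetP => -[x _ ->]; exists x; rewrite ?inE //.
    by rewrite porbit.unlock.
  by rewrite porbit.unlock.
by apply: orbit_partition; apply/actsP=> a _ x; rewrite !inE.
Qed.

Lemma sign_porbits s :
  (-1) ^+ (s : bool) = \prod_(c in porbits s) (-1) ^+ #|c|.-1 :> int.
Proof.
rewrite /odd_perm signr_addb !signr_odd -cardsT.
rewrite (card_partition (porbits_partition s)) -sum1_card !expr_sum -big_split.
apply: eq_bigr => c /imsetP[x _ ->] /=.
have := card_porbit_neq0 s x; case: #|_| => //= m _.
by rewrite expr1 exprSr -mulrA mulN1r opprK mulr1.
Qed.

Lemma stable_porbit s A x : s \in 'N(A | 'P) -> (porbit s x \subset A) = (x \in A).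
Proof.
move=> sA; apply/idP/idP => [/subsetP-> //|xA]; first exact: porbit_id.
apply/subsetP=> _ /porbitP[i ->].
by have := astabsP (groupX i sA) x; rewrite /= /aperm => ->.
Qed.

Lemma stable_cover s A :
  s \in 'N(A | 'P) -> A = cover [set c in porbits s | c \subset A].
Proof.
move=> sA; apply/setP=> x; apply/idP/bigcupP=> [xA|[c]].
  by exists (porbit s x); rewrite ?porbit_id // inE imset_f //= stable_porbit.
by rewrite inE => /andP[_ /subsetP cA] /cA.
Qed.

Lemma cover_stable s (P : {set {set T}}) :
  P \subset porbits s -> s \in 'N(cover P | 'P).
Proof.
move=> sP; rewrite !inE /=; apply/subsetP=> x /bigcupP[c cP xc]; rewrite inE.
apply/bigcupP; exists c => //; have /imsetP[y _ Dc] := subsetP sP c cP.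
rewrite Dc in xc *; rewrite -eq_porbit_mem in xc; rewrite -(eqP xc) /=.
exact: (mem_porbit s 1).
Qed.

(** A cycle of length [l] has sign (-1)^(l-1), and outside [A] the restriction
    only has cycles of length 1. *)
Lemma sign_restr s A : s \in 'N(A | 'P) ->
  (-1) ^+ (restr_perm A s : bool)
    = \prod_(c in porbits s | c \subset A) (-1) ^+ #|c|.-1 :> int.
Proof.
move=> sA; set p := restr_perm A s.
have pE x : x \in A -> p x = s x by move=> xA; rewrite /p restr_permE.
have orbE x : x \in A -> porbit p x = porbit s x.
  move=> xA; suff E i : (p ^+ i)%g x = (s ^+ i)%g x.
    by apply/setP=> y; apply/porbitP/porbitP=> -[i ->]; exists i.
  elim: i => [|i IHi]; first by rewrite !expg0.
  rewrite !expgSr !permM IHi pE //.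
  by have := astabsP (groupX i sA) x; rewrite /= /aperm => ->.
have orbN x : x \notin A -> porbit p x = [set x].
  move=> xA; have px : p x = x by rewrite (out_perm (restr_perm_on A s)).
  have E i : (p ^+ i)%g x = x by elim: i => [|i IHi]; rewrite ?perm1 // expgSr permM IHi.
  apply/setP=> y; rewrite inE; apply/porbitP/eqP=> [[i ->]|->] //.
  by exists 0%N; rewrite perm1.
rewrite sign_porbits (bigID (fun c => c \subset A)) /= [X in _ * X]big1 ?mulr1.
  apply: eq_bigl => c; apply: andb_id2r => cA.
  by apply/imsetP/imsetP=> -[x _ Dc]; exists x => //; rewrite Dc orbE //;
     apply: (subsetP cA); rewrite Dc porbit_id.
move=> _ /andP[/imsetP[x _ ->]]; case: (boolP (x \in A)) => xA.
  by rewrite orbE // stable_porbit // xA.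
by rewrite orbN // cards1.
Qed.

Definition cycle_poly s : {poly int} :=
  \prod_(c in porbits s) (1 - (- 'X) ^+ #|c|).

(** The stable sets are the unions of cycles, so expanding the product selects
    one stable set per term.  The right-hand side is det(1 + X P) for the matrix
    [P] of [s], written as a sum of principal minors. *)
Lemma cycle_polyE s :
  cycle_poly s
    = \sum_(A | s \in 'N(A | 'P)) (-1) ^+ (restr_perm A s : bool) *: 'X^#|A|.
Proof.
pose w c : {poly int} := (-1) ^+ #|c|.-1 *: 'X^#|c|.
have -> : cycle_poly s = \prod_c ((if c \in porbits s then w c else 0) + 1).
  rewrite [RHS](bigID (mem (porbits s))) /= [X in _ * X]big1 ?mulr1; last first.
    by move=> c /negPf->; rewrite add0r.
  apply: eq_bigr => c Pc; rewrite Pc [RHS]addrC; congr (_ + _).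
  have /imsetP[x _ ->] := Pc.
  have := card_porbit_neq0 s x; rewrite /w; case: #|_| => //= m _.
  rewrite (exprNn 'X) [X in - (X * _)]exprS.
  rewrite mulN1r mulNr opprK -signr_odd -[X in _ = X *: _]signr_odd.
  by rewrite scaler_sign mulr_sign.
(* Families containing a set which is not a cycle of [s] contribute 0. *)
rewrite bigA_distr.
rewrite (bigID (fun P : {set {set T}} => P \subset porbits s)) /=.
rewrite [X in _ + X]big1 ?addr0; last first.
  move=> P /subsetPn[c cP Pc]; rewrite (bigD1 c) //= cP (negPf Pc) mul0r //.
rewrite [RHS](reindex_onto (fun P => cover P)
   (fun A => [set c in porbits s | c \subset A])) /=; last first.
  by move=> A sA; rewrite -stable_cover.
have inP (P : {set {set T}}) : P \subset porbits s ->
    [set c in porbits s | c \subset cover P] = P.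
  move=> sP; apply/setP=> c; rewrite inE; apply/andP/idP=> [[]|cP]; last first.
    by split; [exact: (subsetP sP)|exact: bigcup_sup].
  case/imsetP=> x _ -> /subsetP/(_ x (porbit_id _ _))/bigcupP[d dP].
  have /imsetP[y _ Dd] := subsetP sP d dP.
  by move: dP; rewrite Dd -eq_porbit_mem => yP /eqP->.
apply: eq_big => [P|P sP].
  apply/idP/andP=> [sP|[_ /eqP<-]]; first by rewrite inP ?cover_stable.
  by apply/subsetP=> c; rewrite inE => /andP[].
have ->: #|cover P| = (\sum_(c in P) #|c|)%N.
  apply/eqP; rewrite eq_sym; change (trivIset P).
  by apply: trivIsetS sP _; case/and3P: (porbits_partition s).
have -> : (-1) ^+ restr_perm (cover P) s = \prod_(c in P) (-1) ^+ #|c|.-1 :> int.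
  rewrite sign_restr ?cover_stable //; apply: eq_bigl => c.
  by rewrite -{2}(inP P sP) inE.
rewrite expr_sum -scaler_prod -big_mkcond /=; apply: eq_bigr => c cP.
by rewrite (subsetP sP).
Qed.

End CyclePoly.

(** * Counting and sign sums over stabilisers of sets *)

Section StableSets.
Variable T : finType.
Local Open Scope group_scope.
Local Open Scope ring_scope.
Implicit Types (s t p : {perm T}) (A B X Y Z : {set T}) (x y z : T).

Lemma mem_stable A s : (s \in 'N(A | 'P)) = (s @: A == A).
Proof.
apply/idP/eqP=> [sA|E]; first exact: astabs_setact sA.
by apply/astabsP=> x; rewrite /= /aperm -{1}E mem_imset //; apply: perm_inj.
Qed.

(** Exchange a point of [A] outside [B] with a point of [B] outside [A], and
    iterate. *)
Lemma perm_imset A B : #|A| = #|B| -> exists s, s @: A = B.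
Proof.
(* Induction on a bound for the number of points of [B] still to be reached. *)
move: {2}#|B :\: A| (leqnn #|B :\: A|) => m; elim: m A => [|m IHm] A leBA eqAB.
  exists 1%g; apply/eqP; rewrite (eq_imset _ (@perm1 T)) imset_id eq_sym.
  by rewrite eqEcard eqAB leqnn andbT -setD_eq0 -cards_eq0 -leqn0.
have [/eqP BA0|/set0Pn[y]] := boolP (B :\: A == set0).
  by apply: IHm; rewrite // BA0 cards0.
rewrite inE => /andP[yA yB].
have /set0Pn[x] : A :\: B != set0.
  rewrite -cards_eq0 cardsD eqAB setIC -cardsD cards_eq0.
  by apply/set0Pn; exists y; rewrite inE yA.
rewrite inE => /andP[xB xA].
have tI : injective (tperm x y) by apply: perm_inj.
have [||s sE] := IHm (tperm x y @: A); last 1 first.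
- by exists (tperm x y * s)%g; rewrite -sE -imset_comp; apply: eq_imset => z; rewrite permM.
- rewrite -ltnS; apply: leq_trans leBA; apply: proper_card; apply/properP; split.
    apply/subsetP=> z; rewrite !inE => /andP[zA zB]; rewrite zB andbT.
    apply: contra zA => zA; apply/imsetP; exists z => //; rewrite tpermD //.
      by apply: contra xB => /eqP->.
    by apply: contraNneq yA => ->.
  exists y; rewrite !inE ?yA ?yB //= andbT negbK.
  by apply/imsetP; exists x; rewrite ?tpermL.
- by rewrite card_imset.
Qed.

Lemma card_imset_eq A B : #|A| = #|B| ->
  #|[set s : {perm T} | s @: A == B]| = #|'N(A | 'P)|.
Proof.
move=> /perm_imset[g gE]; rewrite -(card_rcoset 'N(A | 'P) g); apply: eq_card => s.
rewrite inE mem_rcoset mem_stable -gE.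
rewrite -(inj_eq (imset_inj (@perm_inj _ g)) ((s * g^-1)%g @: A)) -imset_comp.
by congr (_ == _); apply: eq_imset => x; rewrite /= permM permKV.
Qed.

Lemma restr_permM A s t : s \in 'N(A | 'P) -> t \in 'N(A | 'P) ->
  restr_perm A (s * t)%g = (restr_perm A s * restr_perm A t)%g.
Proof. by move=> sA tA; rewrite morphM. Qed.

Lemma restr_perm_id A s : perm_on A s -> restr_perm A s = s.
Proof.
move=> sA; apply/permP=> x.
have [xA|xA] := boolP (x \in A); last by rewrite !(@out_perm _ A) ?restr_perm_on.
by rewrite restr_permE // mem_stable (im_perm_on sA).
Qed.

Lemma perm_on_stableC A s : perm_on (~: A) s -> s \in 'N(A | 'P).
Proof. by move=> sA; rewrite -astabsC mem_stable (im_perm_on sA). Qed.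

Lemma perm_on_stable A s : perm_on A s -> s \in 'N(A | 'P).
Proof. by move=> sA; rewrite mem_stable (im_perm_on sA). Qed.

Lemma restr_permC1 A s : perm_on (~: A) s -> restr_perm A s = 1%g.
Proof.
move=> sA; apply/permP=> x; rewrite perm1.
have [xA|xA] := boolP (x \in A); last by rewrite (@out_perm _ A) ?restr_perm_on.
by rewrite restr_permE // ?perm_on_stableC // (out_perm sA) // inE xA.
Qed.

Lemma tperm_perm_on A x y : x \in A -> y \in A -> perm_on A (tperm x y).
Proof.
move=> xA yA; apply/subsetP=> z; rewrite inE; case: tpermP => [->|->|] //.
by rewrite eqxx.
Qed.

(** As soon as [s] does not stabilise [A], [restr_perm A s] is the identity and
    this is the default value 1. *)
Definition restr_sign A s : int := (-1) ^+ (restr_perm A s : bool).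

Lemma restr_signM A s t : s \in 'N(A | 'P) -> t \in 'N(A | 'P) ->
  restr_sign A (s * t)%g = restr_sign A s * restr_sign A t.
Proof. by move=> sA tA; rewrite /restr_sign restr_permM // odd_permM signr_addb. Qed.

(** The cycles of [s] inside [A] but not inside [B] lie in the difference, so
    they are fixed points. *)
Lemma restr_sign_sub A B s : s \in 'N(A | 'P) -> s \in 'N(B | 'P) ->
  B \subset A -> (#|A :\: B| <= 1)%N -> restr_sign A s = restr_sign B s.
Proof.
move=> sA sB sBA le1; rewrite /restr_sign !sign_restr //.
rewrite (bigID (fun c : {set T} => c \subset B)) /= [X in _ * X]big1 ?mulr1.
  apply: eq_bigl => c; rewrite -andbA; congr (_ && _).
  by apply: andb_idl => /subset_trans; apply.
move=> _ /andP[/andP[/imsetP[x _ ->] sxA]].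
rewrite stable_porbit // => xB.
suff: (#|porbit s x| <= 1)%N.
  by have := card_porbit_neq0 s x; case: #|_| => [|[|]].
apply: leq_trans le1; apply: subset_leq_card; apply/subsetP=> y yx.
rewrite inE (subsetP sxA) // andbT; apply: contra xB => yB.
by move: yx; rewrite -eq_porbit_mem -(stable_porbit _ sB) => /eqP<-; rewrite stable_porbit.
Qed.

(** Multiplication by the transposition of [x] and [y] reverses the first sign
    and preserves the second one. *)
Lemma sum_restr_sign0 A B x y : x != y -> x \in A :\: B -> y \in A :\: B ->
  \sum_(s in 'N(A | 'P) :&: 'N(B | 'P)) restr_sign A s * restr_sign B s = 0.
Proof.
move=> nxy /setDP[xA xB] /setDP[yA yB].
set S := \sum_(_ in _) _.
have tA := perm_on_stable (tperm_perm_on xA yA).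
have tBon : perm_on (~: B) (tperm x y) by apply: tperm_perm_on; rewrite inE.
have tB := perm_on_stableC tBon.
have: S = - S.
  rewrite {1}/S (reindex_inj (mulgI (tperm x y))) /S -sumrN.
  apply: eq_big => [s|s]; first by rewrite groupMl // in_setI tA tB.
  rewrite groupMl; last by rewrite in_setI tA tB.
  rewrite in_setI => /andP[sA sB].
  rewrite (restr_signM tA sA) (restr_signM tB sB) {1 3}/restr_sign.
  rewrite restr_perm_id ?tperm_perm_on //.
  by rewrite restr_permC1 // odd_tperm nxy odd_perm1 expr1 expr0 mul1r !mulN1r mulNr.
move/eqP; rewrite -addr_eq0 -mulr2n mulrn_eq0 /= => /eqP //.
Qed.

(** The Cauchy-Frobenius count for a transitive action; the transpositions in [K]
    exchange the condition [s z = z] for [s z0 = z], and the latter sets form a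
    partition of [K]. *)
Lemma sum_fix_card (K : {group {perm T}}) Z : Z != set0 ->
  {in Z &, forall x y, tperm x y \in K} ->
  {in K & Z, forall s z, s z \in Z} ->
  (\sum_(z in Z) #|[set s in K | s z == z]| = #|K|)%N.
Proof.
case/set0Pn=> z0 z0Z tK KZ.
transitivity (\sum_(z in Z) #|[set s in K | s z0 == z]|)%N.
  apply: eq_bigr => z zZ; rewrite -!sum1dep_card.
  rewrite (reindex_inj (mulgI (tperm z0 z))) /=; apply: eq_bigl => s.
  by rewrite groupMl ?tK // permM tpermR.
rewrite -[RHS]sum1_card (partition_big (fun s : {perm T} => s z0) (mem Z)) /=.
  by apply: eq_bigr => z _; rewrite -sum1dep_card.
by move=> s sK; apply: KZ.
Qed.

Lemma sum_sign_Sym Z :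
  \sum_(s in perm.Sym Z) (-1) ^+ (s : bool) = (#|Z| <= 1)%N%:R :> int.
Proof.
case: leqP => [le1|/card_gt1P[x [y [xZ yZ nxy]]]].
  rewrite (big_pred1 1%g) ?odd_perm1 // => s; rewrite inE; apply/idP/eqP=> [sZ|->].
    exact: (perm_on_id sZ).
  exact: perm_on1.
set S := \sum_(_ in _) _.
have: S = - S.
  rewrite {1}/S (reindex_inj (mulgI (tperm x y))) /S -sumrN.
  apply: eq_big => [s|s _]; first by rewrite groupMl // inE tperm_perm_on.
  by rewrite odd_permM signr_addb odd_tperm nxy mulN1r.
by move/eqP; rewrite -addr_eq0 -mulr2n mulrn_eq0 /= => /eqP.
Qed.

Lemma card_stable A : (#|'N(A | 'P)| <= #|A|`! * #|~: A|`!)%N.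
Proof.
rewrite -!perm.card_Sym -cardsX.
(* A permutation stabilising [A] is determined by its restrictions. *)
pose f s := (restr_perm A s, restr_perm (~: A) s).
have fI : {in 'N(A | 'P) &, injective f}.
  move=> s t sA tA [E1 E2]; apply/permP=> x.
  have [xA|] := boolP (x \in A); first by rewrite -(restr_permE sA xA) E1 restr_permE.
  rewrite -in_setC => xA; rewrite -(restr_permE _ xA) ?astabsC // E2.
  by rewrite restr_permE // astabsC.
rewrite -(card_in_imset fI); apply: subset_leq_card; apply/subsetP=> _ /imsetP[s _ ->].
by rewrite !inE !restr_perm_on.
Qed.

(** If [s @: Y] meets [X] in at most one point then, by cardinality, it consists
    of the complement of [X] and one point of [X].  So there are at most |X|
    possible images, and each of them comes from at most |Y|! |~: Y|!
    permutations, where |~: Y| = |X| - 1. *)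
Lemma card_meet_le1 X Y : (#|X| + #|Y| = #|T|.+1)%N ->
  (#|[set s : {perm T} | (#|X :&: s @: Y| <= 1)%N]| <= #|X|`! * #|Y|`!)%N.
Proof.
move=> XY; have X0 : (0 < #|X|)%N.
  by have := max_card Y; lia.
pose F := [set x |: ~: X | x in X].
rewrite -sum1dep_card (partition_big (fun s : {perm T} => s @: Y) (mem F)) /=; last first.
  move=> s; set Z := s @: Y => le1.
  have ZY : #|Z| = #|Y| by rewrite card_imset //; apply: perm_inj.
  have sXZ : ~: X \subset Z.
    have : (#|~: X| <= #|~: X :&: Z|)%N.
      have -> : ~: X :&: Z = Z :\: X by rewrite setIC setDE.
      have := cardsID X Z; have := cardsC X; rewrite (setIC Z X); lia.
    by rewrite (geq_leqif (subset_leqif_cards (subsetIl _ _))) => /eqP/setIidPl.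
  have /cards1P[x Dx]: #|X :&: Z| == 1%N.
    rewrite eqn_leq le1 /=.
    have := cardsID X Z; have := cardsC X;
    have := subset_leq_card sXZ; rewrite (setIC Z X).
    have <- : ~: X :&: Z = Z :\: X by rewrite setIC setDE.
    by rewrite (setIidPl sXZ); lia.
  apply/imsetP; exists x; first by move: (set11 x); rewrite -Dx => /setIP[].
  apply/setP=> y; rewrite !inE; have /setP/(_ y) := Dx; rewrite !inE => <-.
  by case: (boolP (y \in X)) => //= yX; rewrite ?orbF // (subsetP sXZ) // inE.
apply: (@leq_trans (\sum_(Z in F) #|Y|`! * #|~: Y|`!)).
  apply: leq_sum => Z _; rewrite sum1dep_card.
  have [ZY|ZY] := eqVneq #|Z| #|Y|.
    rewrite (leq_trans _ (card_stable Y)) // -(card_imset_eq (esym ZY)).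
    by apply: subset_leq_card; apply/subsetP=> s; rewrite !inE => /andP[].
  rewrite (_ : [set _ | _] = set0) ?cards0 //; apply/setP=> s; rewrite !inE.
  apply/negP=> /andP[_ /eqP E]; case/eqP: ZY.
  by rewrite -E card_imset //; apply: perm_inj.
rewrite sum_nat_const.
have -> : #|~: Y| = #|X|.-1 by have := cardsC Y; lia.
rewrite -[X in (_ <= X`! * _)%N](prednK X0) factS (prednK X0).
apply: (@leq_trans (#|X| * (#|Y|`! * #|X|.-1`!))).
  by rewrite leq_mul2r leq_imset_card orbT.
by rewrite -mulnA [(_`! * #|X|.-1`!)%N]mulnC.
Qed.

End StableSets.

(** * Exterior powers of the permutation representation *)

Section ExteriorPowers.
Variable n : nat.
Local Open Scope group_scope.
Local Open Scope ring_scope.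
Local Notation G := [set: 'S_n].
Implicit Types (s t p : 'S_n) (A X Y Z : {set 'I_n}) (x y z : 'I_n).

Lemma sgn_cfE s : sgn_cf n s = (-1) ^+ (s : bool).
Proof. by rewrite cfunE. Qed.

Lemma sgn_cf_lin_char : sgn_cf n \is a linear_char.
Proof.
pose rho s : 'M[algC]_1 := ((-1) ^+ (s : bool))%:M.
have rhoP : mx_repr G rho.
  split=> [|s t _ _]; first by rewrite /rho odd_perm1.
  by rewrite /rho odd_permM signr_addb scalar_mxM.
rewrite qualifE /=; apply/andP; split; last by rewrite sgn_cfE odd_perm1.
have -> : sgn_cf n = cfRepr (MxRepresentation rhoP).
  by apply/cfunP=> s; rewrite sgn_cfE cfunE inE mulr1n /= mxtrace_scalar.
exact: cfRepr_char.
Qed.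

(** The sign of the action on [X] as a character of the stabiliser of [X]: the
    sign of the first factor of Sym X x Sym (~: X). *)
Definition stab_sign X : 'CF('N(X | 'P)) :=
  cfMorph ('Res[restr_perm X @* 'N(X | 'P)] (sgn_cf n)).

Lemma stab_signE X s : s \in 'N(X | 'P) -> stab_sign X s = (restr_sign X s)%:~R.
Proof.
move=> sX; rewrite /stab_sign cfMorphE //.
by rewrite cfResE ?subsetT ?mem_morphim // sgn_cfE /restr_sign rmorphXn /= rmorphN1.
Qed.

Lemma stab_sign_lin_char X : stab_sign X \is a linear_char.
Proof. exact: cfMorph_lin_char (cfRes_lin_char _ sgn_cf_lin_char). Qed.

(** The character of the exterior power of degree [#|X|] of the permutation
    representation.  Any set of the right size may be used for inducing
    ([ext_char_card]); different choices are convenient at different places. *)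
Definition ext_char X : 'CF(G) := 'Ind[G] (stab_sign X).

Lemma ext_char_char X : ext_char X \is a character.
Proof. exact: cfInd_char (lin_charW (stab_sign_lin_char X)). Qed.

Lemma stableJ X s t : ((s ^ t^-1)%g \in 'N(X | 'P)) = (s \in 'N(t @: X | 'P)).
Proof.
rewrite !mem_stable -(inj_eq (imset_inj (@perm_inj _ t)) ((s ^ t^-1)%g @: X)) -!imset_comp.
by congr (_ == _); apply: eq_imset => x; rewrite /= !permM invgK permKV.
Qed.

Lemma restr_signJ X s t : s \in 'N(t @: X | 'P) ->
  restr_sign X (s ^ t^-1)%g = restr_sign (t @: X) s.
Proof.
move=> sX; rewrite /restr_sign -(odd_permJ (restr_perm (t @: X) s) t^-1%g).
congr (_ ^+ odd_perm _); apply/permP=> x; rewrite !permM invgK.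
have [xX|xX] := boolP (x \in X).
  by rewrite restr_permE ?stableJ // restr_permE ?imset_f // !permM invgK.
rewrite (out_perm (restr_perm_on _ _)) // (out_perm (restr_perm_on _ _)) ?permK //.
by rewrite mem_imset //; apply: perm_inj.
Qed.

(** In the induction formula, the conjugate of [s] by the inverse of [t]
    stabilises [X] exactly if [s] stabilises [t @: X]; each set of size [#|X|]
    arises from as many [t] as the stabiliser of [X] has elements. *)
Lemma ext_charE X s :
  ext_char X s
    = \sum_(A : {set 'I_n} | (#|A| == #|X|) && (s \in 'N(A | 'P))) (restr_sign A s)%:~R.
Proof.
rewrite /ext_char cfIndE ?subsetT // (reindex_inj invg_inj) /=.
apply: (mulfI (neq0CG 'N(X | 'P))); rewrite mulrA mulfV ?neq0CG // mul1r.
rewrite (partition_big (fun t : 'S_n => t @: X) (fun A => #|A| == #|X|)) /=; last first.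
  by move=> t _; rewrite card_imset //; apply: perm_inj.
rewrite mulr_sumr big_mkcondr /=; apply: eq_bigr => A /eqP AX.
rewrite -(card_imset_eq (esym AX)) -sum1dep_card natr_sum mulr_suml.
rewrite [RHS](_ : _ = \sum_(t : 'S_n | t @: X == A)
    if s \in 'N(A | 'P) then (restr_sign A s)%:~R else 0); last first.
  by case: ifP => _; [apply: eq_bigr => t _; rewrite mul1r | rewrite big1].
apply: eq_big => [t|t]; first by rewrite !inE.
case/andP=> _ /eqP <-; case: ifP => sA.
  by rewrite stab_signE ?stableJ // restr_signJ.
by apply: cfun0; rewrite stableJ sA.
Qed.

Lemma ext_char_card X Y : #|X| = #|Y| -> ext_char X = ext_char Y.
Proof. by move=> XY; apply/cfunP=> s; rewrite !ext_charE XY. Qed.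

(** The contribution of the set [A] to the scalar product of the exterior power
    of degree [#|X|] with the one of degree [#|A|], after Frobenius reciprocity. *)
Definition sign_overlap X A : int :=
  \sum_(s in 'N(X | 'P) :&: 'N(A | 'P)) restr_sign X s * restr_sign A s.

Lemma sign_overlap0 X A : (1 < #|A :\: X|)%N -> sign_overlap X A = 0.
Proof.
case/card_gt1P=> x [y [xA yA nxy]]; rewrite /sign_overlap setIC.
under eq_bigr do rewrite mulrC.
exact: (sum_restr_sign0 nxy).
Qed.

Lemma sign_overlap_card X A : (#|A :\: X| <= 1)%N -> (#|X :\: A| <= 1)%N ->
  sign_overlap X A = #|'N(X | 'P) :&: 'N(A | 'P)|%:R.
Proof.
move=> AX XA; rewrite /sign_overlap -sum1_card natr_sum; apply: eq_bigr => s /setIP[sX sA].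
have sI : s \in 'N(X :&: A | 'P) by apply: (subsetP (astabsI _ _ _)); rewrite inE sX.
rewrite (restr_sign_sub sX sI) ?subsetIl ?setDIr ?setDv ?set0U //.
rewrite (restr_sign_sub sA sI) ?subsetIr ?setDIr ?setDv ?setU0 //.
by rewrite /restr_sign -signr_addb addbb.
Qed.

Lemma dot_ext_char X Y :
  '[ext_char X, ext_char Y]
    = #|'N(X | 'P)|%:R^-1 * (\sum_(A : {set 'I_n} | #|A| == #|Y|) sign_overlap X A)%:~R.
Proof.
rewrite /ext_char -cfdot_Res_r -/(ext_char Y) cfdotE; congr (_ * _).
rewrite rmorph_sum /=.
under [RHS]eq_bigr => A _ do rewrite rmorph_sum /=.
rewrite (exchange_big_dep (mem 'N(X | 'P))) /=; last by move=> A s _ /setIP[].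
apply: eq_bigr => s sX; rewrite cfResE ?subsetT // stab_signE // ext_charE.
rewrite rmorph_sum mulr_sumr /=; apply: eq_big => [A|A _]; first by rewrite [in RHS]in_setI sX.
by rewrite rmorphM /= rmorph_int.
Qed.

Lemma dot_ext_char_far X Y : (#|X|.+1 < #|Y|)%N -> '[ext_char X, ext_char Y] = 0.
Proof.
move=> ltXY; rewrite dot_ext_char big1 ?mulr0 // => A /eqP AY.
by apply: sign_overlap0; have := cardsID X A; have := subset_leq_card (subsetIr A X); lia.
Qed.

Lemma stable_setU1 X z : z \notin X ->
  'N(X | 'P) :&: 'N(z |: X | 'P) = [set s in 'N(X | 'P) | s z == z].
Proof.
move=> zX; apply/setP=> s; rewrite in_setI [RHS]inE; apply: andb_id2l => sX.
apply/idP/eqP=> [szX|sz].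
  have := astabs_act z szX; rewrite /= /aperm setU11 => /setU1P[//|].
  by have := astabs_act z sX; rewrite /= /aperm (negPf zX) => ->.
apply: (subsetP (astabsU _ _ _)); rewrite in_setI sX andbT mem_stable.
by rewrite imset_set1 sz.
Qed.

Lemma sum_fix_out X (K : {group 'S_n}) : X != setT -> K \subset 'N(X | 'P) ->
  {in ~: X &, forall x y, tperm x y \in K} ->
  (\sum_(z in ~: X) #|[set s in K | s z == z]| = #|K|)%N.
Proof.
move=> XT KX tK; apply: sum_fix_card => //.
  by apply: contra XT => /eqP E; rewrite -(setCK X) E setC0.
move=> s z sK zX; rewrite -(astabsC _ X) in KX.
by have := astabs_act z (subsetP KX _ sK); rewrite /= /aperm zX.
Qed.

(** Only the sets [z |: X] contribute.  Their contributions are the numbers of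
    elements of the stabiliser of [X] which fix [z], and the stabiliser acts
    transitively on the complement of [X]. *)
Lemma dot_ext_char_next X Y : #|Y| = #|X|.+1 -> '[ext_char X, ext_char Y] = 1.
Proof.
move=> YX; have XT : X != setT.
  by apply: contra_eq_neq YX => ->; rewrite cardsT; have := max_card Y; lia.
rewrite dot_ext_char; set S := \sum_(_ | _) _; suff -> : S = #|'N(X | 'P)|%:R.
  by rewrite rmorph_nat mulVf // neq0CG.
rewrite -(sum_fix_out XT (subxx _)); last first.
  by move=> x y xX yX; apply/perm_on_stableC/tperm_perm_on.
rewrite natr_sum /S (bigID (mem [set z |: X | z in ~: X])) /= [X in _ + X]big1 ?addr0.
  rewrite (eq_bigl (mem [set z |: X | z in ~: X])).
    rewrite big_imset /=; last first.
      move=> x z; rewrite !inE => xX zX /setP/(_ x); rewrite !inE eqxx (negPf xX) /= orbF.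
      by move/esym/eqP.
    apply: eq_bigr => z; rewrite inE => zX.
    rewrite sign_overlap_card ?stable_setU1 //.
      by rewrite setDUl setDv setU0 (leq_trans (subset_leq_card (subsetDl _ _))) ?cards1.
    by rewrite (eqP (_ : X :\: _ == set0)) ?cards0 // setD_eq0 subsetUr.
  move=> A /=; apply: andb_idl => /imsetP[z]; rewrite inE => zX ->.
  by rewrite cardsU1 zX YX.
move=> A /andP[/eqP AY]; apply: contraNeq => nz0.
have le1 : (#|A :\: X| <= 1)%N by rewrite leqNgt; apply: contra nz0 => /sign_overlap0->.
have AI := cardsID X A.
have sXA : X \subset A.
  have : (#|X| <= #|A :&: X|)%N.
    by rewrite -(leq_add2r #|A :\: X|) AI AY YX -addn1 leq_add2l.
  rewrite (geq_leqif (subset_leqif_cards (subsetIr _ _))) => /eqP EX.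
  by rewrite -EX subsetIl.
have /cards1P[z Dz] : #|A :\: X| == 1%N.
  by move: AI; rewrite (setIidPr sXA) AY YX -addn1 => /addnI ->.
have : z \in A :\: X by rewrite Dz set11.
rewrite inE => /andP[zX zA]; apply/imsetP; exists z; rewrite ?inE //.
by rewrite -Dz setUC -{1}(setIidPr sXA) setID.
Qed.

End ExteriorPowers.

(** * Norms, and irreducibility of the hook characters *)

Section HookCharacters.
Variable n : nat.
Local Open Scope group_scope.
Local Open Scope ring_scope.
Local Notation G := [set: 'S_n].
Implicit Types (s t p : 'S_n) (A X Y Z : {set 'I_n}) (x y z : 'I_n).

Lemma stable_swap1 X x z : x \in X -> z \notin X ->
  'N(X | 'P) :&: 'N(z |: X :\ x | 'P)
    = [set s in [group of 'N(X | 'P) :&: 'C[x | 'P]] | s z == z].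
Proof.
move=> xX zX; apply/setP=> s; rewrite [LHS]in_setI [RHS]inE [X in _ = X && _]in_setI -andbA.
apply: andb_id2l => sX.
apply/idP/andP=> [sA|[/astab1P sx /eqP sz]].
  have inA y : (s y \in z |: X :\ x) = (y \in z |: X :\ x) := astabs_act y sA.
  have inX y : (s y \in X) = (y \in X) := astabs_act y sX.
  split.
    apply/astab1P; apply/eqP; have := inA x; have := inX x.
    rewrite /= /aperm xX !inE eqxx /= orbF => sxX; rewrite sxX andbT.
    have /negPf-> : s x != z by apply: contraNneq zX => <-.
    have /negPf-> : x != z by apply: contraNneq zX => <-.
    by move/negbFE.
  have := inA z; have := inX z; rewrite !inE eqxx (negPf zX) => ->.
  by rewrite andbF orbF.
have sXx : s \in 'N(X :\ x | 'P).
  rewrite setDE; apply: (subsetP (astabsI _ _ _)).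
  by rewrite in_setI sX astabsC mem_stable imset_set1 [s x]sx /=.
apply: (subsetP (astabsU _ _ _)); rewrite in_setI sXx andbT mem_stable.
by rewrite imset_set1 sz.
Qed.

(** Besides [X] itself, only the sets obtained from [X] by exchanging one point
    [x] for a point [z] outside contribute.  Summing first over [z] and then over
    [x], the transitivity count applies twice, and the total contribution of
    these sets is again the order of the stabiliser. *)
Lemma dot_ext_char_self X : X != set0 -> X != setT -> '[ext_char X] = 2.
Proof.
move=> X0 XT; rewrite dot_ext_char; set S := \sum_(_ | _) _.
suff -> : S = (#|'N(X | 'P)| + #|'N(X | 'P)|)%:R.
  by rewrite rmorph_nat natrD mulrDr mulVf ?neq0CG.
have fixX : (\sum_(x in X) #|'N(X | 'P) :&: 'C[x | 'P]| = #|'N(X | 'P)|)%N.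
  rewrite -[RHS](@sum_fix_card _ [group of 'N(X | 'P)] X X0) /=; last 2 first.
  - by move=> x y xX yX; apply/perm_on_stable/tperm_perm_on.
  - by move=> s z sX zX; have := astabs_act z sX; rewrite /= /aperm zX.
  apply: eq_bigr => x _; apply: eq_card => s; rewrite in_setI [RHS]inE.
  by congr (_ && _); apply/astab1P/eqP.
rewrite /S (bigD1 X) //= natrD; congr (_ + _).
  by rewrite sign_overlap_card ?setDv ?cards0 // setIid.
(* [F] consists of the sets obtained from [X] by one exchange. *)
pose F := [set z |: X :\ x | x in X, z in ~: X].
rewrite (bigID (mem F)) /= [X in _ + X]big1 ?addr0; last first.
  move=> A /andP[/andP[/eqP AX nAX]]; apply: contraNeq => nz0.
  have le1 : (#|A :\: X| <= 1)%N by rewrite leqNgt; apply: contra nz0 => /sign_overlap0->.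
  have eqD : #|A :\: X| = #|X :\: A|.
    by apply/eqP; rewrite -(eqn_add2l #|A :&: X|) cardsID setIC cardsID AX.
  have A0 : #|A :\: X| == 1%N.
    rewrite eqn_leq le1 lt0n cards_eq0; apply: contra nAX => A0.
    have := A0; rewrite -cards_eq0 eqD cards_eq0.
    by rewrite !setD_eq0 in A0 * => XA; rewrite eqEsubset A0.
  have /cards1P[x Dx] := A0; rewrite eqD in A0; have /cards1P[y Dy] := A0.
  have : x \in A :\: X by rewrite Dx set11.
  have : y \in X :\: A by rewrite Dy set11.
  rewrite !inE => /andP[yA yX] /andP[xX xA].
  apply/imset2P; exists y x; rewrite ?inE // -Dx -Dy setDDr setDv set0U setIC.
  by rewrite setUC setID.
rewrite (eq_bigl (mem F)); last first.
  move=> A /=; apply: andb_idl => /imset2P[x z xX]; rewrite inE => zX ->.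
  rewrite cardsU1 !inE (negPf zX) andbF /=.
  have := cardsD1 x X; rewrite xX => ->; rewrite eqxx /=.
  by apply: contra zX => /eqP <-; rewrite setU11.
rewrite -fixX natr_sum /F.
rewrite (_ : [set _ | x in X, z in ~: X]
   = [set u.2 |: X :\ u.1 | u in setX X (~: X)]); last first.
  apply/setP=> A; apply/imset2P/imsetP => [[x z xX zX ->]|[[x z] /setXP[xX zX] ->]].
    by exists (x, z); rewrite ?inE //= xX; rewrite inE in zX.
  by exists x z.
rewrite big_imset /=; last first.
  move=> [x z] [x' z'] /setXP[/= xX zX] /setXP[/= x'X z'X] E.
  rewrite !inE in zX z'X.
  have : z \in z' |: X :\ x' by rewrite -E setU11.
  rewrite !inE (negPf zX) andbF orbF => /eqP Ez; congr (_, _); last by [].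
  have /setP/(_ x) := E; rewrite !inE eqxx xX /= andbT orbF -Ez.
  have /negPf-> : x != z by apply: contraNneq zX => <-.
  by move/esym/negbFE/eqP.
rewrite (eq_bigl (fun u => (u.1 \in X) && (u.2 \in ~: X))); last first.
  by case=> x z; rewrite in_setX.
rewrite -(pair_big (mem X) (mem (~: X)) (fun x z => sign_overlap X (z |: X :\ x))) /=.
apply: eq_bigr => x xX.
rewrite -(@sum_fix_out _ X [group of 'N(X | 'P) :&: 'C[x | 'P]] XT (subsetIl _ _)); last first.
  move=> y z yX zX; rewrite in_setI; apply/andP; split.
    exact/perm_on_stableC/tperm_perm_on.
  rewrite !inE in yX zX; apply/astab1P; rewrite /= /aperm tpermD //.
    by apply: contraNneq yX => ->.
  by apply: contraNneq zX => ->.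
rewrite natr_sum; apply: eq_bigr => z; rewrite inE => zX.
rewrite sign_overlap_card ?stable_swap1 //.
  rewrite -(cards1 z); apply: subset_leq_card; apply/subsetP=> y; rewrite !inE.
  by case: (y \in X) => //=; rewrite andbF orbF.
rewrite -(cards1 x); apply: subset_leq_card; apply/subsetP=> y; rewrite !inE.
by case: (y \in X); rewrite ?andbF // !andbT negb_or negbK => /andP[].
Qed.

Lemma ext_char_set0 : ext_char (set0 : {set 'I_n}) = 1.
Proof.
apply/cfunP=> s; rewrite ext_charE cfun1E inE cards0 (big_pred1 set0).
  by rewrite /restr_sign (perm_on_id (restr_perm_on _ _)) ?cards0 // odd_perm1.
move=> A; rewrite cards_eq0; apply: andb_idr => /eqP->.
by rewrite mem_stable imset0.
Qed.

(** Young subgroups of hook shape are the symmetric groups of these sets. *)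
Definition initial i : {set 'I_n} := [set x : 'I_n | (x < i)%N].

Lemma card_initial i : (i <= n)%N -> #|initial i| = i.
Proof.
move=> le_in; rewrite -sum1dep_card -(big_ord_widen n (fun=> 1%N)) //.
by rewrite sum1_card card_ord.
Qed.

(** The alternating sum of the exterior powers of degree at most [j], that is,
    the exterior power of degree [j] of the (n-1)-dimensional summand of the
    permutation representation. *)
Fixpoint hook_chi j : 'CF(G) :=
  if j is i.+1 then ext_char (initial j) - hook_chi i else ext_char (initial 0).

Lemma hook_chi_vchar j : hook_chi j \in 'Z[irr G].
Proof.
elim: j => [|j IHj] /=; first exact: char_vchar (ext_char_char _).
by apply: rpredB IHj; apply: char_vchar (ext_char_char _).
Qed.

(** The exterior power of degree [j + 1] is [hook_chi j.+1 + hook_chi j]; the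
    norm of [hook_chi j.+1] is 2 - 1 - (1 - 1) = 1. *)
Lemma hook_chi_dot j : (j < n)%N ->
  [/\ '[hook_chi j] = 1, '[hook_chi j, ext_char (initial j)] = 1,
       '[hook_chi j, ext_char (initial j.+1)] = 1
     & forall i, (j.+1 < i <= n)%N -> '[hook_chi j, ext_char (initial i)] = 0].
Proof.
elim: j => [|j IHj] ltjn.
  have E0: initial 0 = set0 by apply/setP=> x; rewrite !inE.
  split=> [|||i /andP[lt1i le_in]] /=.
  - by rewrite E0 ext_char_set0 cfnorm1.
  - by rewrite E0 ext_char_set0 cfnorm1.
  - by rewrite dot_ext_char_next ?card_initial.
  by rewrite dot_ext_char_far ?card_initial.
have [N1 _ Nj N0] := IHj (ltnW ltjn).
have NO : '[ext_char (initial j.+1)] = 2.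
  have cI := card_initial (ltnW ltjn).
  apply: dot_ext_char_self; first by rewrite -cards_eq0 cI.
  by apply: contraTneq ltjn => E; rewrite -cI E cardsT card_ord ltnn.
have Nj' : '[ext_char (initial j.+1), hook_chi j] = 1 by rewrite cfdotC Nj conjC1.
split=> [|||i /andP[lti le_in]] /=.
- by rewrite cfdotBl !cfdotBr NO N1 Nj Nj' subrr subr0 addrK.
- by rewrite cfdotBl NO Nj addrK.
- by rewrite cfdotBl dot_ext_char_next ?card_initial // ?N0 ?subr0 // ?ltnSn // ltnW.
by rewrite cfdotBl dot_ext_char_far ?N0 ?subrr // ?card_initial // ltnW // ltnW.
Qed.

(** [xi] is a constituent of the restriction of the irreducible character to [H],
    so its own restriction to [K] is one of the restriction to [K]. *)
Lemma constt_Ind_sub (gT : finGroupType) (L H K : {group gT}) (xi : 'CF(H)) i :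
    K \subset H -> H \subset L -> xi \is a linear_char ->
  i \in irr_constt ('Ind[L] xi) -> i \in irr_constt ('Ind[L] ('Res[K] xi)).
Proof.
move=> sKH sHL xi_lin; have /irrP[l Dl] := lin_char_irr xi_lin.
have /irrP[r Dr] := lin_char_irr (cfRes_lin_char K xi_lin).
rewrite Dr Dl !constt_Ind_Res => il.
rewrite -(cfResRes _ sKH sHL).
apply: (constt_Res_trans _ il); first exact: cfRes_char (irr_char _).
by rewrite -Dl Dr irr_consttE cfnorm_irr oner_eq0.
Qed.

Lemma perm_onP X s : reflect (forall x, x \notin X -> s x = x) (perm_on X s).
Proof.
apply: (iffP idP) => [sX x|sX]; first exact: out_perm.
by apply/subsetP=> x; rewrite inE; apply: contraR => /sX/eqP.
Qed.

Lemma perm_onI X Y s : perm_on (X :&: Y) s = perm_on X s && perm_on Y s.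
Proof.
apply/perm_onP/andP=> [sI|[/perm_onP sX /perm_onP sY] x].
  by split; apply/perm_onP=> x xN; apply: sI; rewrite inE (negPf xN) ?andbF.
by rewrite inE negb_and => /orP[/sX|/sY].
Qed.

Lemma perm_onJ Y s t : perm_on Y (s ^ t^-1)%g = perm_on (t @: Y) s.
Proof.
have tI := @perm_inj _ t.
apply/perm_onP/perm_onP=> sY x xY.
  have [y Dx] : exists y, x = t y by exists ((t^-1)%g x); rewrite permKV.
  rewrite Dx mem_imset // in xY; have := sY y xY.
  by rewrite !permM invgK -Dx => /(canRL (permKV t)) ->.
by rewrite !permM invgK sY ?permK // mem_imset.
Qed.

(** By Frobenius reciprocity |X|! |Y|! times this scalar product is the sum, over
    all [t], of the signs of the elements of Sym (X :&: t @: Y).  Such a sum is 0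
    unless the intersection has at most one point, and then it is 1. *)
Lemma dot_Ind_Sym_le1 X Y (K L : {group 'S_n}) : (#|X| + #|Y| = n.+1)%N ->
    K :=: perm.Sym X -> L :=: perm.Sym Y ->
  '['Ind[G, K] 1, 'Ind[G, L] ('Res[L] (sgn_cf n))] <= 1.
Proof.
move=> XY KX LY; have memK s : (s \in K) = perm_on X s by rewrite KX inE.
have memL s : (s \in L) = perm_on Y s by rewrite LY inE.
rewrite -cfdot_Res_r cfdotE ler_pdivrMl ?gt0CG // mulr1.
have -> : \sum_(s in K) (1 : 'CF(K)) s * (('Res[K] ('Ind[G] ('Res[L] (sgn_cf n)))) s)^*
   = #|L|%:R^-1 * (\sum_(t : 'S_n) (#|X :&: t @: Y| <= 1)%N)%:R.
  transitivity (#|L|%:R^-1 * \sum_(s in K) \sum_(t : 'S_n | perm_on (t @: Y) s)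
      (-1) ^+ (s : bool) : algC).
    rewrite mulr_sumr; apply: eq_bigr => s sK; rewrite cfun1E sK mul1r.
    rewrite cfResE ?subsetT // cfIndE ?subsetT // rmorphM fmorphV rmorph_nat.
    congr (_ * _); rewrite (reindex_inj invg_inj) rmorph_sum /= big_mkcond [RHS]big_mkcond.
    apply: eq_bigr => t _; rewrite in_setT -perm_onJ -memL; case: ifP => sL.
      by rewrite cfResE ?subsetT // sgn_cfE odd_permJ rmorph_sign.
    by rewrite cfun0 ?sL ?conjC0.
  congr (_ * _); rewrite (exchange_big_dep predT) //= natr_sum; apply: eq_bigr => t _.
  have := congr1 (fun z : int => z%:~R : algC) (sum_sign_Sym (X :&: t @: Y)).
  rewrite rmorph_sum rmorph_nat /= => <-; apply: eq_big => [s|s _]; last by rewrite rmorph_sign.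
  by rewrite memK in_set perm_onI.
rewrite ler_pdivrMl ?gt0CG // -natrM ler_nat KX LY !perm.card_Sym mulnC.
by rewrite -big_mkcond sum1dep_card card_meet_le1 // card_ord.
Qed.

(** A virtual character of norm 1 is irreducible up to sign; the sign is positive
    since the scalar product with a genuine character is 1. *)
Lemma hook_chi_irr j : (j < n)%N -> exists i, hook_chi j = 'chi_i.
Proof.
move=> ltjn; have [N1 _ Nj _] := hook_chi_dot ltjn.
have [b [i Dpsi]] := vchar_norm1P (hook_chi_vchar j) N1.
case: b Dpsi => Dpsi; last by exists i; rewrite Dpsi scale1r.
have := Cnat_cfdot_char (irr_char i) (ext_char_char (initial j.+1)).
move/natr_ge0; have := Nj; rewrite Dpsi expr1 scaleN1r cfdotNl.
by move/(canRL (@opprK _))=> ->; rewrite oppr_ge0 ler10.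
Qed.

Lemma conj_hook_part k : (0 < k <= n)%N ->
  conj_part (hook_part n k) = hook_part n (n - k).+1.
Proof.
case/andP; case: k => // k _ le_kn; rewrite /conj_part /hook_part /=.
rewrite /mkseq /=; congr (_ :: _).
  by rewrite count_nseq /= mul1n add1n.
rewrite subnSK // subKn 1?ltnW //.
apply: (@eq_from_nth _ 0%N); first by rewrite size_map size_iota size_nseq.
move=> i; rewrite size_map size_iota => lt_ik.
rewrite (nth_map 0%N) ?size_iota // nth_iota // nth_nseq lt_ik.
by rewrite count_nseq add1n ltnS lt_ik.
Qed.

Lemma reshape_index_hook k i : (i < n)%N ->
  reshape_index (hook_part n k) i = (if i < k then 0 else (i - k).+1)%N.
Proof.
have aux m j : (j < m)%N -> find (pred1 0%N) (scanl subn j.+1 (nseq m 1)) = j.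
  elim: m j => //= m IHm [|j] lt_jm //=; rewrite subn1 /=.
  by rewrite IHm.
move=> lt_in; rewrite /hook_part /reshape_index /= subn_eq0; case: ltnP => // le_ki.
by rewrite subSn // aux // ltn_sub2r // (leq_ltn_trans le_ki).
Qed.

End HookCharacters.

(** * The hook characters as common constituents *)

Arguments initial {n}.
Arguments hook_chi {n}.

Section HookIdentification.
Variable n : nat.
Local Open Scope group_scope.
Local Open Scope ring_scope.
Local Notation G := [set: 'S_n].
Implicit Types (s t p : 'S_n) (A X Y Z : {set 'I_n}) (x y z : 'I_n).

Lemma young_hook k : (0 < k <= n)%N ->
  young_group n (hook_part n k) :=: perm.Sym (initial k).
Proof.
case/andP=> k0 le_kn; apply/setP=> s; rewrite [LHS]inE [RHS]inE.
apply/forallP/idP=> [sY|sX i]; last first.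
  have [ik|] := boolP (i \in initial k); last by move/(out_perm sX)->.
  have := perm_closed i sX; rewrite ik !inE => six; rewrite inE in ik.
  by rewrite !reshape_index_hook // six ik.
apply/perm_onP=> i; rewrite inE => /negPf ik; have := sY i.
rewrite !reshape_index_hook // ik; case: ltnP => // le_ks /eqP[E].
apply: val_inj; rewrite /= -(subnK le_ks) E subnK // leqNgt ik //.
Qed.

(** For the trivial character one induces through the stabiliser of the
    complement of [initial k], on which Sym (initial k) acts trivially; for the
    sign, through the stabiliser of [initial j.+1]. *)
Lemma sym_chi_hook k : (0 < k <= n)%N -> sym_chi n (hook_part n k) = hook_chi (n - k).
Proof.
move=> kP; have /andP[k0 le_kn] := kP; set j := (n - k)%N.
have ltjn : (j < n)%N by rewrite /j; lia.
have [N1 Nj Nj1 _] := hook_chi_dot ltjn.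
have [i Di] := hook_chi_irr ltjn.
rewrite /sym_chi conj_hook_part // -/j.
set a := 'Ind[_, _] 1; set b := 'Ind[_, _] _.
have Ka := young_hook kP.
have Kb := @young_hook j.+1 ltjn.
have ia : i \in irr_constt a.
  pose X : {set 'I_n} := ~: initial k.
  have cX : #|X| = j.
    rewrite -[j](card_initial (ltnW ltjn)) /j cardsCs setCK card_ord.
    by rewrite !card_initial // leq_subr.
  have sKN : young_group n (hook_part n k) \subset 'N(X | 'P).
    by apply/subsetP=> s; rewrite Ka astabsC in_set; apply: perm_on_stable.
  have := @constt_Ind_sub _ [group of G] [group of 'N(X | 'P)]
    (young_group n (hook_part n k)) (stab_sign X) i sKN (subsetT _) (stab_sign_lin_char X).
  rewrite -/(ext_char X) (@ext_char_card _ X (initial j)); last by rewrite card_initial // ltnW.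
  rewrite irr_consttE cfdotC -Di Nj conjC1 oner_eq0 => /(_ isT).
  suff -> : 'Res[young_group n (hook_part n k)] (stab_sign X) = 1 by [].
  apply/cfun_inP=> s sK; rewrite cfResE // stab_signE ?(subsetP sKN) // cfun1E sK.
  rewrite Ka in_set in sK.
  by rewrite /restr_sign restr_permC1 ?odd_perm1 // setCK.
have ib : i \in irr_constt b.
  pose X : {set 'I_n} := initial j.+1.
  have sKN : young_group n (hook_part n j.+1) \subset 'N(X | 'P).
    by apply/subsetP=> s; rewrite Kb in_set; apply: perm_on_stable.
  have := @constt_Ind_sub _ [group of G] [group of 'N(X | 'P)]
    (young_group n (hook_part n j.+1)) (stab_sign X) i sKN (subsetT _)
    (stab_sign_lin_char X).
  rewrite -/(ext_char X) irr_consttE cfdotC -Di Nj1 conjC1 oner_eq0 => /(_ isT).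
  suff -> : 'Res[young_group n (hook_part n j.+1)] (stab_sign X) = 'Res (sgn_cf n) by [].
  apply/cfun_inP=> s sK; rewrite !cfResE ?subsetT // stab_signE ?(subsetP sKN) //.
  rewrite Kb in_set in sK.
  by rewrite /restr_sign restr_perm_id // sgn_cfE rmorph_sign.
have a_char : a \is a character by apply: cfInd_char; apply: cfun1_char.
have b_char : b \is a character.
  by apply: cfInd_char; apply: cfRes_char; exact: lin_charW (sgn_cf_lin_char _).
have le1 : '[a, b] <= 1.
  apply: (@dot_Ind_Sym_le1 n (initial k) (initial j.+1)) => //.
  by rewrite !card_initial // /j; lia.
have cN i' : i' \in irr_constt a -> i' \in irr_constt b ->
    1 <= '[a, 'chi_i'] * '[b, 'chi_i'].
  rewrite !irr_consttE => nza nzb.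
  have /natrP[x Dx] := Cnat_cfdot_char a_char (irr_char i').
  have /natrP[y Dy] := Cnat_cfdot_char b_char (irr_char i').
  rewrite Dx Dy -natrM ler1n muln_gt0 !lt0n.
  by rewrite Dx pnatr_eq0 in nza; rewrite Dy pnatr_eq0 in nzb; rewrite nza nzb.
have uniq_i i' : i' \in irr_constt a -> i' \in irr_constt b -> i' = i.
  move=> i'a i'b; apply/eqP/negPn/negP => ni.
  suff : 1 + 1 <= 1 :> algC by rewrite gerDl ler10.
  apply: le_trans le1; rewrite cfdot_char_r // (bigD1 i) // (bigD1 i') //= addrA.
  rewrite -[X in X <= _]addr0; apply: lerD; first by apply: lerD; apply: cN.
  by apply: sumr_ge0 => l _; rewrite mulr_ge0 // natr_ge0 ?Cnat_cfdot_char_irr.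
by case: pickP => [i' /andP[i'a i'b]|/(_ i)]; rewrite ?ia ?ib // (uniq_i i').
Qed.

Lemma ext_char_coef s i : (i <= n)%N ->
  ext_char (initial i) s = ((cycle_poly s)`_i)%:~R.
Proof.
move=> le_in; rewrite ext_charE card_initial // cycle_polyE coef_sum rmorph_sum /=.
rewrite big_mkcondl [RHS]big_mkcond [LHS]big_mkcond; apply: eq_bigr => A _.
case: ifP => // sA; rewrite coefZ coefXn eq_sym; case: eqP => _; first by rewrite mulr1.
by rewrite mulr0.
Qed.

(** If W = (1 + X) V then V_j = W_j - V_(j-1), which is the recursion defining
    [hook_chi]. *)
Lemma hook_chiE j s V : (j < n)%N -> cycle_poly s = (1 + 'X) * V ->
  hook_chi j s = (V`_j)%:~R.
Proof.
move=> ltjn EV; have W i : (cycle_poly s)`_i = V`_i + (if i is i'.+1 then V`_i' else 0).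
  by rewrite EV mulrDl mul1r coefD coefXM; case: i.
elim: j ltjn => [|j IHj] ltjn /=; first by rewrite ext_char_coef // W addr0.
by rewrite !cfunE ext_char_coef ?(ltnW ltjn) // IHj ?(ltnW ltjn) // W rmorphD /= addrK.
Qed.

Lemma sym_chi_int_hook k s V : (0 < k <= n)%N -> cycle_poly s = (1 + 'X) * V ->
  sym_chi_int (hook_part n k) s = V`_(n - k).
Proof.
move=> kP EV; rewrite /sym_chi_int sym_chi_hook // (hook_chiE _ EV) ?intrKfloor //.
by case/andP: kP; lia.
Qed.

End HookIdentification.

(** * Permutations with few moved points *)

Section CycleTypes.
Variable T : finType.
Local Open Scope group_scope.
Local Open Scope ring_scope.
Implicit Types (s t : {perm T}) (c d : {set T}) (x y : T).

Definition moved s := [set x | s x != x].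

Lemma mem_moved s x : (x \in moved s) = (1 < #|porbit s x|)%N.
Proof.
rewrite inE; apply/idP/card_gt1P=> [sx|[y [z [yx zx nyz]]]].
  by exists (s x), x; rewrite sx porbit_id (mem_porbit s 1).
apply: contraNneq nyz => sx.
have fix_x i : (s ^+ i)%g x = x.
  by elim: i => [|i IHi]; rewrite ?perm1 // expgSr permM IHi.
by case/porbitP: yx => i ->; case/porbitP: zx => j ->; rewrite !fix_x.
Qed.

Lemma moved_stable s : s \in 'N(moved s | 'P).
Proof. by apply/astabsP=> x; rewrite /= /aperm !inE (inj_eq perm_inj). Qed.

Lemma porbit_moved s x : x \in moved s -> porbit s x \subset moved s.
Proof. by rewrite (stable_porbit _ (moved_stable s)). Qed.

Definition long_orbits s := [set c in porbits s | (1 < #|c|)%N].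

Lemma long_orbits_porbit s x : (porbit s x \in long_orbits s) = (x \in moved s).
Proof. by rewrite inE imset_f // mem_moved. Qed.

Lemma long_orbitsP s c :
  reflect (exists2 x, x \in moved s & c = porbit s x) (c \in long_orbits s).
Proof.
apply: (iffP idP) => [|[x xs ->]]; last by rewrite long_orbits_porbit.
rewrite inE => /andP[/imsetP[x _ ->]]; rewrite -mem_moved => xs; by exists x.
Qed.

Lemma trivIset_long_orbits s : trivIset (long_orbits s).
Proof.
apply: (@trivIsetS _ _ (porbits s)); last by case/and3P: (porbits_partition s).
by apply/subsetP=> c; rewrite inE => /andP[].
Qed.

Lemma cover_long_orbits s : cover (long_orbits s) = moved s.
Proof.
apply/setP=> x; apply/bigcupP/idP=> [[c /long_orbitsP[y ys ->]]|xs].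
  exact: (subsetP (porbit_moved ys)).
by exists (porbit s x); rewrite ?porbit_id ?long_orbits_porbit.
Qed.

Lemma sum_long_orbits s : (\sum_(c in long_orbits s) #|c| = #|moved s|)%N.
Proof. by rewrite -cover_long_orbits; apply/eqP; apply: trivIset_long_orbits. Qed.

Lemma cycle_poly_long s :
  cycle_poly s = (1 + 'X) ^+ (#|T| - #|moved s|)
                   * \prod_(c in long_orbits s) (1 - (- 'X) ^+ #|c|).
Proof.
rewrite /cycle_poly (bigID (fun c : {set T} => (1 < #|c|)%N)) /= mulrC; congr (_ * _); last first.
  by apply: eq_bigl => c; rewrite inE.
have card1 c : (c \in porbits s) && ~~ (1 < #|c|)%N -> #|c| = 1%N.
  by case/andP=> /imsetP[x _ ->]; have := card_porbit_neq0 s x; case: #|_| => [|[|]].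
under eq_bigr => c /card1-> do rewrite expr1 opprK.
rewrite prodr_const; congr (_ ^+ _); apply/eqP.
rewrite -(eqn_add2r #|moved s|) subnK ?max_card // -sum_long_orbits.
rewrite -[#|T|]cardsT (card_partition (porbits_partition s)).
rewrite [X in _ == X](bigID (fun c : {set T} => (1 < #|c|)%N)) /= addnC.
apply/eqP; congr (_ + _)%N; first by apply: eq_bigl => c; rewrite inE.
by rewrite (eq_bigr (fun=> 1%N)) ?sum1_card.
Qed.

Definition is_cycle s := moved s \in porbits s.

Lemma is_cycle_porbit s x : is_cycle s -> x \in moved s -> porbit s x = moved s.
Proof.
by case/imsetP=> y _ ->; rewrite -eq_porbit_mem => /eqP.
Qed.

Lemma long_orbits_cycle s : is_cycle s -> (1 < #|moved s|)%N ->
  long_orbits s = [set moved s].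
Proof.
move=> cs gt1; apply/setP=> c; rewrite [RHS]inE; apply/long_orbitsP/eqP=> [[x xs ->]|->].
  exact: is_cycle_porbit.
have /card_gt0P[x xs]: (0 < #|moved s|)%N by apply: ltnW.
by exists x; rewrite ?is_cycle_porbit.
Qed.

(** Long orbits have at least two points, so five moved points leave no room for
    a third one. *)
Lemma small_two_orbits s : (0 < #|moved s| <= 5)%N -> ~~ is_cycle s ->
  exists c d, [/\ c != d, long_orbits s = [set c; d],
    (1 < #|c|)%N, (1 < #|d|)%N & (#|c| + #|d| = #|moved s|)%N].
Proof.
case/andP=> /card_gt0P[x xs] le5 ncs; set c := porbit s x.
have cQ : c \in long_orbits s by rewrite long_orbits_porbit.
have big e : e \in long_orbits s -> (1 < #|e|)%N by rewrite inE => /andP[].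
have sumQ := sum_long_orbits s.
have [Q0|/set0Pn[d dQ]] := eqVneq (long_orbits s :\ c) set0.
  case/negP: ncs; rewrite /is_cycle -cover_long_orbits -(setD1K cQ) Q0 setU0 /cover big_set1.
  exact: imset_f.
have [Q0|/set0Pn[e eQ]] := eqVneq (long_orbits s :\ c :\ d) set0; last first.
  rewrite (big_setD1 c) // (big_setD1 d) // (big_setD1 e) //= in sumQ.
  have /setD1P[_ /setD1P[_ /big e1]] := eQ.
  have /setD1P[_ /big d1] := dQ.
  by have := big _ cQ; move: sumQ le5 d1 e1; lia.
have /setD1P[ndc dQ'] := dQ.
have DQ : long_orbits s = [set c; d] by rewrite -(setD1K cQ) -(setD1K dQ) Q0 setU0.
exists c, d; split; rewrite ?big // 1?eq_sym //.
by rewrite -sumQ DQ big_setU1 ?big_set1 // inE eq_sym.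
Qed.

Lemma moved_small s : #|moved s| != 1%N.
Proof.
apply/negP=> /cards1P[x Dx]; have : x \in moved s by rewrite Dx set11.
rewrite mem_moved => gt1; have := porbit_moved (s := s) (x := x).
by rewrite mem_moved gt1 => /(_ isT)/subset_leq_card; rewrite Dx cards1 leqNgt gt1.
Qed.

Lemma moved_eq0 s : (#|moved s| == 0%N) = (s == 1%g).
Proof.
rewrite cards_eq0; apply/eqP/eqP=> [s0|->].
  apply/permP=> x; rewrite perm1; apply/eqP; rewrite -[_ == _]negbK.
  by have := in_set0 x; rewrite -s0 inE => ->.
by apply/setP=> x; rewrite !inE perm1 eqxx.
Qed.

Lemma small_cycle s : (1 < #|moved s| <= 3)%N -> is_cycle s.
Proof.
move=> /andP[lt1 le3]; apply/negPn/negP=> /small_two_orbits[|c [d [_ _ c1 d1]]].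
  by rewrite (ltnW lt1) (leq_trans le3).
by lia.
Qed.

Lemma invol_porbit s x : (s * s == 1)%g -> x \in moved s -> #|porbit s x| = 2%N.
Proof.
move=> /eqP ss xs; apply/eqP; rewrite eqn_leq -mem_moved xs andbT.
apply: (@leq_trans #|[set x; s x]|); last by rewrite cards2; case: eqP.
apply: subset_leq_card; apply/subsetP=> y /porbitP[i ->].
have E k : (s ^+ k * s ^+ k = 1)%g by rewrite -expgMn ?ss ?expg1n.
rewrite -(odd_double_half i) -addnn !expgD E.
by case: (odd i); rewrite ?mulg1 ?expg1 ?expg0 ?perm1 !inE eqxx ?orbT.
Qed.

Lemma orbits2_invol s :
  (forall x, x \in moved s -> #|porbit s x| = 2%N) -> (s * s = 1)%g.
Proof.
move=> s2; apply/permP=> x; rewrite permM perm1.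
have [xs|] := boolP (x \in moved s); last by rewrite inE negbK => /eqP sx; rewrite !sx.
by rewrite -[RHS](iter_porbit s x) s2.
Qed.

(** The alternative to a 4-cycle is two orbits of length 2. *)
Lemma invol4 s : #|moved s| = 4%N -> (s * s == 1)%g = ~~ is_cycle s.
Proof.
move=> s4; apply/idP/idP=> [ss|ncs].
  apply/negP=> cs; have /card_gt0P[x xs]: (0 < #|moved s|)%N by rewrite s4.
  by have := invol_porbit ss xs; rewrite is_cycle_porbit // s4.
have [|c [d [ncd DQ c1 d1 cd]]] := small_two_orbits _ ncs; first by rewrite s4.
apply/eqP/orbits2_invol => x; rewrite -long_orbits_porbit DQ inE !in_set1.
by case/orP=> /eqP->; lia.
Qed.

Lemma cycle_poly_cycle s : is_cycle s -> (1 < #|moved s|)%N ->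
  cycle_poly s = (1 + 'X) ^+ (#|T| - #|moved s|) * (1 - (- 'X) ^+ #|moved s|).
Proof. by move=> cs gt1; rewrite cycle_poly_long long_orbits_cycle // big_set1. Qed.

Lemma cycle_poly_22 s : #|moved s| = 4%N -> (s * s = 1)%g ->
  cycle_poly s = (1 + 'X) ^+ (#|T| - 4) * ((1 - 'X^2) * (1 - 'X^2)).
Proof.
move=> s4 ss; have ncs : ~~ is_cycle s by rewrite -invol4 // ss.
have [|c [d [ncd DQ c1 d1 cd]]] := small_two_orbits _ ncs; first by rewrite s4.
rewrite cycle_poly_long s4 DQ big_setU1 ?inE // big_set1.
have [-> ->] : #|c| = 2%N /\ #|d| = 2%N by split; lia.
by rewrite sqrrN.
Qed.

Lemma orbits_32 s : #|moved s| = 5%N -> ~~ is_cycle s ->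
  exists c d, [/\ c != d, long_orbits s = [set c; d], #|c| = 3%N & #|d| = 2%N].
Proof.
move=> s5 ncs.
have [|c [d [ncd DQ c1 d1 cd]]] := small_two_orbits _ ncs; first by rewrite s5.
have [c3|c3] := eqVneq #|c| 3; first by exists c, d; split=> //; lia.
by exists d, c; rewrite eq_sym setUC; split=> //; lia.
Qed.

Lemma cycle_poly_32 s : #|moved s| = 5%N -> ~~ is_cycle s ->
  cycle_poly s = (1 + 'X) ^+ (#|T| - 5) * ((1 + 'X^3) * (1 - 'X^2)).
Proof.
move=> s5 ncs; have [c [d [ncd DQ c3 d2]]] := orbits_32 s5 ncs.
rewrite cycle_poly_long s5 DQ big_setU1 ?inE // big_set1 c3 d2 sqrrN.
by rewrite [in X in 1 - X]exprNn -signr_odd /= expr1 mulN1r opprK.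
Qed.

End CycleTypes.

(** * Cyclic permutations along the edges of a graph *)

Section GraphPerms.
Variables (n : nat) (e : rel 'I_n).
Hypotheses (e_sym : symmetric e) (e_irr : irreflexive e).
Local Open Scope group_scope.
Local Open Scope ring_scope.
Implicit Types (s t : 'S_n) (x y z : 'I_n).

(** These are the permutations which contribute to the immanant. *)
Definition graph_perm s := [forall x, (x \in moved s) ==> e x (s x)].

(** For a cyclic permutation along edges this is the cycle that it traverses, and
    for an involution along edges it is the corresponding matching. *)
Definition edge_set s : {set {set 'I_n}} := [set [set x; s x] | x in moved s].

Lemma graph_permP s : reflect {in moved s, forall x, e x (s x)} (graph_perm s).
Proof. exact: 'forall_implyP. Qed.

Lemma pair_inj x y z : x != z -> [set x; y] = [set x; z] -> y = z.
Proof.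
move=> xz /setP/(_ z); rewrite !inE eqxx orbT eq_sym (negPf xz) /=.
by move/eqP.
Qed.

Lemma moved_perm s x : (s x \in moved s) = (x \in moved s).
Proof. exact: astabs_act x (moved_stable s). Qed.

Lemma cover_edge_set s : cover (edge_set s) = moved s.
Proof.
apply/setP=> x; apply/bigcupP/idP=> [[_ /imsetP[y ys ->]]|xs].
  by rewrite !inE => /orP[]/eqP->; move: ys; rewrite inE ?(inj_eq perm_inj).
by exists [set x; s x]; [apply: imset_f | rewrite set21].
Qed.

Lemma movedV s : moved s^-1%g = moved s.
Proof.
by apply/setP=> x; rewrite !inE -(inj_eq (@perm_inj _ s)) permKV eq_sym.
Qed.

(** The only pairs {x, y} in [edge_set s] have [y = s x] or [x = s y]. *)
Lemma neighbour s t x : edge_set t = edge_set s -> x \in moved s ->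
  t x = s x \/ t x = s^-1%g x.
Proof.
move=> Ets xs; have xt : x \in moved t by rewrite -cover_edge_set Ets cover_edge_set.
have : [set x; t x] \in edge_set s by rewrite -Ets; apply: imset_f.
have tx : x != t x by move: xt; rewrite inE eq_sym.
case/imsetP=> y ys E; have : x \in [set y; s y] by rewrite -E set21.
rewrite !inE => /orP[]/eqP Dx; [left|right].
  rewrite Dx in E tx *; apply/esym; apply: (pair_inj tx); exact: esym E.
have Dy : y = s^-1%g x by rewrite Dx permK.
by rewrite -Dy; apply/esym/(pair_inj tx); rewrite E setUC -Dx.
Qed.

Lemma edge_setV s : edge_set s^-1%g = edge_set s.
Proof.
apply/setP=> c; apply/imsetP/imsetP=> -[x xs ->].
  by exists (s^-1%g x); rewrite ?permKV 1?setUC // -movedV moved_perm movedV -movedV.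
by exists (s x); rewrite ?permK 1?setUC // movedV moved_perm.
Qed.

Lemma is_cycleV s : is_cycle s^-1%g = is_cycle s.
Proof. by rewrite /is_cycle movedV porbitsV. Qed.

Lemma graph_permV s : graph_perm s^-1%g = graph_perm s.
Proof.
wlog suff imp : s / graph_perm s -> graph_perm s^-1%g.
  by apply/idP/idP=> /imp //; rewrite invgK.
move=> /graph_permP gs; apply/graph_permP=> x; rewrite movedV => xs.
rewrite e_sym; have := gs (s^-1%g x); rewrite permKV; apply.
by rewrite -moved_perm permKV.
Qed.

Lemma eq_moved_edge s t : edge_set t = edge_set s -> moved t = moved s.
Proof. by rewrite -!cover_edge_set => ->. Qed.

Lemma cycle_period s x : is_cycle s -> (2 < #|moved s|)%N -> x \in moved s ->
  s (s x) != x.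
Proof.
move=> cs gt2 xs; apply: contraTneq gt2 => ssx; rewrite -leqNgt.
rewrite -(is_cycle_porbit cs xs); apply: (@leq_trans #|[set x; s x]|).
  apply: subset_leq_card; apply/subsetP=> _ /porbitP[i ->].
  elim: i => [|i]; first by rewrite perm1 set21.
  by rewrite expgSr permM !inE => /orP[]/eqP->; rewrite ?ssx eqxx ?orbT.
by rewrite cards2; case: eqP.
Qed.

(** If [t] agrees with [s] at [y], its value at [s y] is [s (s y)] or [y]; the
    second value would make [t] of period 2 at [y].  So [t] follows [s] along
    its only long orbit. *)
Lemma edge_set_follow s t x : is_cycle s -> is_cycle t -> (2 < #|moved s|)%N ->
  edge_set t = edge_set s -> x \in moved s -> t x = s x -> t = s.
Proof.
move=> cs ct gt2 Ets xs txs; have Em := eq_moved_edge Ets.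
have follow i : t ((s ^+ i)%g x) = s ((s ^+ i)%g x).
  elim: i => [|i IHi]; first by rewrite perm1.
  rewrite expgSr permM; set y := (s ^+ i)%g x in IHi *.
  have ys : y \in moved s.
    by apply: (subsetP (porbit_moved xs)); apply: mem_porbit.
  have sys : s y \in moved s by rewrite moved_perm.
  have [//|E] := neighbour Ets sys.
  rewrite permK -IHi in E; have := cycle_period ct; rewrite Em => /(_ y gt2 ys).
  by rewrite E eqxx.
apply/permP=> y; have [ys|ys] := boolP (y \in moved s).
  by move: ys; rewrite -(is_cycle_porbit cs xs) => /porbitP[i ->].
have yt : y \notin moved t by rewrite Em.
by move: ys yt; rewrite !inE !negbK => /eqP-> /eqP->.
Qed.

Lemma edge_set_cycle s t : is_cycle s -> is_cycle t -> (2 < #|moved s|)%N ->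
  (edge_set t == edge_set s) = (t \in [set s; s^-1%g]).
Proof.
move=> cs ct gt2; rewrite !inE; apply/eqP/orP=> [Ets|[]/eqP->]; rewrite ?edge_setV //.
have /card_gt0P[x xs] : (0 < #|moved s|)%N by apply: ltn_trans gt2.
case: (neighbour Ets xs) => txs; [left|right]; apply/eqP.
  exact: edge_set_follow txs.
by apply: edge_set_follow txs; rewrite ?is_cycleV ?movedV ?edge_setV.
Qed.

Definition graph_cycle l s := [&& graph_perm s, is_cycle s & #|moved s| == l].

Lemma edge_set_in_cycles l s : (2 < l)%N -> graph_cycle l s -> edge_set s \in cycles e l.
Proof.
move=> l2 /and3P[/graph_permP gs cs /eqP sl].
have /card_gt0P[x xs] : (0 < #|moved s|)%N by rewrite sl (ltn_trans _ l2).
have pl : #|porbit s x| = l by rewrite is_cycle_porbit.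
have szp : size (traject s x l) == l by rewrite size_traject.
have memp y : (y \in traject s x l) = (y \in moved s).
  by rewrite -pl -porbit_traject is_cycle_porbit.
have cp : fcycle s (traject s x l).
  case: l {sl szp memp} l2 pl => // l _ pl.
  have E : rcons (traject s (s x) l) x = traject s (s x) l.+1.
    by rewrite trajectSr -iterSr -pl iter_porbit.
  by change (fpath s x (rcons (traject s (s x) l) x)); rewrite E fpath_traject.
apply/imsetP; exists (Tuple szp); last first.
  apply/setP=> c; apply/imsetP/imsetP=> -[y]; rewrite /= ?memp => yp ->;
    exists y; rewrite /= ?memp //.
    by rewrite (eqP (next_cycle cp _)) ?memp.
  by rewrite (eqP (next_cycle cp _)) ?memp.
have up : uniq (traject s x l) by rewrite -pl uniq_traject_porbit.
rewrite inE l2 /ucycleb /= up andbT; apply: cycle_from_next => // y yp.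
by rewrite -(eqP (next_cycle cp yp)); apply: gs; rewrite -memp.
Qed.

Lemma cycles_edge_set l C : (2 < l)%N -> C \in cycles e l ->
  exists2 s, graph_cycle l s & edge_set s = C.
Proof.
move=> l2 /imsetP[p]; rewrite inE l2 /= => /andP[cp up] ->.
have nI := can_inj (prev_next up); pose s : 'S_n := perm nI.
have sE y : s y = next p y by rewrite permE.
have ms : moved s = [set y in p].
  apply/setP=> y; rewrite !inE sE; have [yp|yp] := boolP (y \in val p).
    by apply: contraTneq (next_cycle cp yp) => ->; rewrite e_irr.
  by rewrite next_nth (negPf yp) eqxx.
exists s; last first.
  apply/setP=> c; apply/imsetP/imsetP=> -[y yp ->]; exists y; rewrite ?sE //.
    by move: yp; rewrite ms inE.
  by rewrite ms inE.
apply/and3P; split.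
- by apply/graph_permP=> y; rewrite ms inE sE => /(next_cycle cp).
- have := cycle_next up; case Dp: (val p) => [|x q] cq.
    by have := size_tuple p; rewrite Dp /= => l0; rewrite -l0 in l2.
  have memp y : (y \in p) = (y \in x :: q) by rewrite -Dp.
  apply/imsetP; exists x => //; apply/setP=> y; rewrite ms inE.
  have xm : x \in moved s by rewrite ms inE memp mem_head.
  apply/idP/idP=> [|yx]; last first.
    by have := subsetP (porbit_moved xm) y yx; rewrite ms inE.
  rewrite memp inE => /orP[/eqP->|yq]; first exact: porbit_id.
  have {}cq : fpath s x (rcons q x).
    have sq a : s a = next (x :: q) a by rewrite sE -Dp.
    by move: cq; apply: sub_path => a b; rewrite /= sq.
  have /fpathP[m Dq] := cq; have : y \in rcons q x by rewrite mem_rcons inE yq orbT.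
  rewrite Dq => /trajectP[i _ ->]; rewrite -iterSr -permX; exact: mem_porbit.
by rewrite ms cardsE (card_uniqP up) size_tuple.
Qed.

(** The two permutations over a cycle are its two orientations, which differ
    because the length is at least 3. *)
Lemma sum_graph_cycles (V : nmodType) (g : {set 'I_n} -> V) l : (2 < l)%N ->
  \sum_(s | graph_cycle l s) g (moved s) = (\sum_(C in cycles e l) g (cover C)) *+ 2.
Proof.
move=> l2; rewrite (partition_big edge_set (mem (cycles e l))) /=; last first.
  by move=> s; apply: edge_set_in_cycles.
rewrite -sumrMnl; apply: eq_bigr => C /(cycles_edge_set l2)[s sP DC].
have /and3P[gs cs /eqP sl] := sP; have gt2 : (2 < #|moved s|)%N by rewrite sl.
have ns : s != s^-1%g.
  have /card_gt0P[x xs] : (0 < #|moved s|)%N by apply: ltn_trans gt2.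
  by apply: contraNneq (cycle_period cs gt2 xs) => E; rewrite {1}E permK.
rewrite (eq_bigl (mem [set s; s^-1%g])) => [|t]; last first.
  rewrite -DC /=; apply/andP/idP=> [[/and3P[_ ct _]]|ts].
    by rewrite edge_set_cycle.
  have -> : graph_cycle l t.
    by move: ts; rewrite !inE => /orP[]/eqP->; rewrite /graph_cycle ?graph_permV ?is_cycleV ?movedV.
  by move: ts; rewrite !inE => /orP[]/eqP->; rewrite ?edge_setV.
by rewrite big_setU1 ?inE // big_set1 movedV -DC cover_edge_set mulr2n.
Qed.

End GraphPerms.

(** * Involutions along the edges of a graph *)

Section Matchings.
Variables (n : nat) (e : rel 'I_n).
Hypotheses (e_sym : symmetric e) (e_irr : irreflexive e).
Local Open Scope group_scope.
Local Open Scope ring_scope.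
Implicit Types (s t : 'S_n) (x y z : 'I_n) (M P : {set {set 'I_n}}).

Lemma edgesP (E : {set 'I_n}) :
  reflect (exists x y, e x y /\ E = [set x; y]) (E \in edges e).
Proof.
rewrite inE; apply: (iffP existsP) => [[x /existsP[y /andP[exy /eqP->]]]|[x [y [exy ->]]]].
  by exists x, y.
by exists x; apply/existsP; exists y; rewrite exy eqxx.
Qed.

Lemma adj_neq x y : e x y -> x != y.
Proof. by apply: contraTneq => ->; rewrite e_irr. Qed.

Lemma edges_pair x y : ([set x; y] \in edges e) = e x y.
Proof.
apply/edgesP/idP => [[i [j [eij E]]]|exy]; last by exists x, y.
have : i \in [set x; y] by rewrite E set21.
rewrite !inE => /orP[]/eqP Di; rewrite Di in E eij.
  by rewrite (pair_inj (adj_neq eij) E).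
rewrite [LHS]setUC in E; rewrite e_sym.
by rewrite (pair_inj (adj_neq eij) E).
Qed.

Lemma card_edge (E : {set 'I_n}) : E \in edges e -> #|E| = 2%N.
Proof. by case/edgesP=> x [y [/adj_neq nxy ->]]; rewrite cards2 nxy. Qed.

Lemma edge_other (E : {set 'I_n}) x : E \in edges e -> x \in E ->
  exists2 y, e x y & E = [set x; y].
Proof.
case/edgesP=> i [j [eij ->]]; rewrite !inE => /orP[]/eqP->; first by exists j.
by exists i; rewrite ?(e_sym j) // setUC.
Qed.

Definition graph_invol l s :=
  [&& graph_perm e s, (s * s == 1)%g & #|moved s| == (2 * l)%N].

Lemma edge_set_sub s : graph_perm e s -> edge_set s \subset edges e.
Proof.
by move=> /graph_permP gs; apply/subsetP=> _ /imsetP[x /gs esx ->]; rewrite edges_pair.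
Qed.

Lemma invol_edge_at s c z : (s * s = 1)%g -> c \in edge_set s -> z \in c ->
  c = [set z; s z].
Proof.
move=> ss /imsetP[x xs ->]; rewrite !inE => /orP[]/eqP-> //.
by rewrite -permM ss perm1 setUC.
Qed.

Lemma edge_set_in_matchings l s : graph_invol l s -> edge_set s \in matchings e l.
Proof.
case/and3P=> gs /eqP ss /eqP sl; rewrite inE edge_set_sub //=.
have tI : trivIset (edge_set s).
  apply/trivIsetP=> c d cs ds; apply: contraNT => /pred0Pn[z /andP[zc zd]].
  by rewrite (invol_edge_at ss cs zc) (invol_edge_at ss ds zd).
rewrite tI /=; rewrite -cover_edge_set -(eqP tI) in sl.
rewrite (eq_bigr (fun=> 2%N)) ?sum_nat_const in sl; last first.
  by move=> c cs; apply: card_edge; apply: (subsetP (edge_set_sub gs)).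
by rewrite -(eqn_pmul2r (isT : (0 < 2)%N)) sl mulnC.
Qed.

(** Exchange the ends of every edge of the matching. *)
Lemma matchings_edge_set l M : M \in matchings e l ->
  exists2 s, graph_invol l s & edge_set s = M.
Proof.
rewrite inE => /and3P[/subsetP sM /trivIsetP tM /eqP cM].
have Minj c d z : c \in M -> d \in M -> z \in c -> z \in d -> c = d.
  move=> cm dm zc zd; apply/eqP; apply: contraT => ncd.
  by have := pred0P (tM _ _ cm dm ncd) z; rewrite /= zc zd.
(* [f x] is the other end of the edge of [M] through [x], if there is one. *)
pose f x := odflt x [pick y | [set x; y] \in M].
have fP x y : [set x; y] \in M -> f x = y.
  move=> xyM; rewrite /f; case: pickP => [z xzM|/(_ y)]; last by rewrite xyM.
  have xz : e x z by rewrite -edges_pair sM.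
  apply/esym; apply: (pair_inj (adj_neq xz)).
  by apply: (Minj _ _ x) => //; rewrite set21.
have fin x : x \in cover M -> [set x; f x] \in M.
  case/bigcupP=> c cM' xc; have [y exy Dc] := edge_other (sM c cM') xc.
  by rewrite (fP x y) -Dc.
have fout x : x \notin cover M -> f x = x.
  move=> xM; rewrite /f; case: pickP => //= y xyM; case/negP: xM.
  by apply/bigcupP; exists [set x; y]; rewrite ?set21.
have fK : involutive f.
  move=> x; have [xM|xM] := boolP (x \in cover M); last by rewrite !(fout x).
  by apply: fP; rewrite setUC fin.
pose s : 'S_n := perm (can_inj fK).
have sE x : s x = f x by rewrite permE.
have ms : moved s = cover M.
  apply/setP=> x; rewrite inE sE; have [xM|/fout->] := boolP (x \in cover M); last by rewrite eqxx.
  by have := sM _ (fin x xM); rewrite edges_pair eq_sym => /adj_neq.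
have EM : edge_set s = M.
  apply/setP=> c; apply/imsetP/idP=> [[x]|cm]; first by rewrite ms sE => xs ->; apply: fin.
  have [x [y [exy Dc]]] := edgesP _ (sM c cm); exists x.
    by rewrite ms; apply/bigcupP; exists c; rewrite // Dc set21.
  by rewrite sE (fP x y) -?Dc.
exists s => //; apply/and3P; split.
- by apply/graph_permP=> x; rewrite ms sE => /fin/sM; rewrite edges_pair.
- by apply/eqP/permP=> x; rewrite permM perm1 !sE fK.
have tI : trivIset M by apply/trivIsetP.
have cE : (\sum_(c in M) #|c|)%N = #|cover M| := eqP tI.
rewrite ms -cE -cM mulnC -sum_nat_const.
by apply/eqP; apply: eq_bigr => c /sM/card_edge.
Qed.

Lemma sum_graph_invol (V : nmodType) (g : {set 'I_n} -> V) l :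
  \sum_(s | graph_invol l s) g (moved s) = \sum_(M in matchings e l) g (cover M).
Proof.
have -> : matchings e l = @edge_set n @: [set s | graph_invol l s].
  apply/setP=> M; apply/idP/imsetP=> [/matchings_edge_set[s sP <-]|[s]].
    by exists s; rewrite ?inE.
  by rewrite inE => sP ->; apply: edge_set_in_matchings.
rewrite big_imset /=.
  by apply: eq_big => s; rewrite ?inE // cover_edge_set.
move=> s t; rewrite !inE => /and3P[_ /eqP ss _] /and3P[_ /eqP tt _] E.
apply/permP=> x; have [xs|xs] := boolP (x \in moved t).
  have tV : (t^-1 = t)%g by apply/eqP; rewrite eq_invg_mul tt.
  by case: (neighbour E xs); rewrite ?tV.
have xs' : x \notin moved s by rewrite (eq_moved_edge E).
by move: xs xs'; rewrite !inE !negbK => /eqP-> /eqP->.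
Qed.

Lemma sum_matchings1 (V : nmodType) (g : {set 'I_n} -> V) :
  \sum_(M in matchings e 1) g (cover M) = \sum_(E in edges e) g E.
Proof.
have -> : matchings e 1 = set1 @: edges e.
  apply/setP=> M; rewrite inE; apply/and3P/imsetP=> [[sM _ /cards1P[E DM]]|[E Ee ->]].
    by exists E; rewrite // (subsetP sM) // DM set11.
  by rewrite sub1set Ee cards1 /trivIset /cover !big_set1.
rewrite big_imset /=; last by move=> E F _ _; apply: set1_inj.
by apply: eq_bigr => E _; rewrite /cover big_set1.
Qed.

Definition edges_at x := [set E in edges e | x \in E].

Lemma card_edges_at x : #|edges_at x| = deg e x.
Proof.
rewrite /deg -(@card_in_imset _ _ (fun y => [set x; y])).
  apply: eq_card => E; rewrite inE; apply/andP/imsetP=> [[Ee xE]|[y]].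
    by have [y exy ->] := edge_other Ee xE; exists y; rewrite ?inE.
  by rewrite inE => exy ->; rewrite edges_pair set21.
by move=> y z; rewrite !inE => exy exz; apply/pair_inj/adj_neq.
Qed.

(** Count the pairs of a vertex in [A] and an edge through it in two ways. *)
Lemma sum_deg_in (A : {set 'I_n}) :
  (\sum_(x in A) deg e x = \sum_(E in edges e) #|E :&: A|)%N.
Proof.
under eq_bigr do rewrite -card_edges_at -sum1_card.
rewrite (exchange_big_dep (mem (edges e))) /=; last by move=> x E _ /setIdP[].
apply: eq_bigr => E Ee; rewrite sum1_card; apply: eq_card => x.
by rewrite in_setI andbC unfold_in [E \in _]in_set Ee.
Qed.

End Matchings.

(** * Edge counts *)

Section Counts.
Variables (n : nat) (e : rel 'I_n).
Hypotheses (e_sym : symmetric e) (e_irr : irreflexive e).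
Local Open Scope group_scope.
Local Open Scope ring_scope.
Implicit Types (s t a b : 'S_n) (x y z : 'I_n) (M P : {set {set 'I_n}}).

Lemma handshake : (\sum_(x : 'I_n) deg e x = 2 * #|edges e|)%N.
Proof.
transitivity (\sum_(x in [set: 'I_n]) deg e x)%N; first by apply: eq_bigl => x; rewrite inE.
rewrite (sum_deg_in e_sym e_irr).
rewrite mulnC -sum_nat_const; apply: eq_bigr => E Ee.
by rewrite setIT (card_edge e_irr).
Qed.

(** Two distinct edges are disjoint or share exactly one vertex, and the pairs of
    edges through [x] are counted by the binomial coefficient at [x]. *)
Lemma card_matchings2 :
  (#|matchings e 2| + \sum_(x : 'I_n) 'C(deg e x, 2) = 'C(#|edges e|, 2))%N.
Proof.
rewrite -cards_draws; under eq_bigr do rewrite -(card_edges_at e_sym e_irr) -cards_draws.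
rewrite -[RHS](cardsID (matchings e 2)); congr (_ + _)%N.
  by apply: eq_card => P; rewrite !inE; case: (P \subset _); case: trivIset; case: eqP.
under eq_bigr do rewrite -sum1_card.
rewrite -sum1_card.
rewrite (exchange_big_dep (mem ([set A : {set {set 'I_n}} |
  A \subset edges e & #|A| == 2%N] :\: matchings e 2))) /=.
  apply: eq_bigr => P; rewrite !inE => /andP[nP /andP[sP cP]].
  have /cards2P[E [F [nEF DP]]] := cP.
  have Ee : E \in edges e by rewrite (subsetP sP) // DP set21.
  have Fe : F \in edges e by rewrite (subsetP sP) // DP set22.
  have nt : ~~ trivIset P by apply: contra nP => tP; rewrite sP tP cP.
  rewrite sum1_card.
  have [x Dx]: exists x, E :&: F = [set x].
    apply/cards1P; rewrite eqn_leq; apply/andP; split.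
      rewrite leqNgt; apply: contra nEF => gt1.
      have EF1 : E :&: F = E.
        by apply/eqP; rewrite eqEcard subsetIl (card_edge e_irr Ee).
      have EF2 : E :&: F = F.
        by apply/eqP; rewrite eqEcard subsetIr (card_edge e_irr Fe).
      by rewrite -{1}EF1 EF2.
    rewrite card_gt0 setI_eq0; apply/negP=> dEF; case/negP: nt; apply/trivIsetP=> A B.
    rewrite DP !inE => /orP[]/eqP-> /orP[]/eqP->; rewrite ?eqxx //.
    by rewrite disjoint_sym.
  transitivity #|[set x]|; last exact: cards1.
  apply: eq_card => y; rewrite -Dx in_setI.
  transitivity (P \in [set A : {set {set 'I_n}} |
    A \subset edges_at e y & #|A| == 2%N]); first by [].
  rewrite in_set cP andbT.
  apply/subsetP/andP=> [sy|[yE yF] A].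
    by split; [have := sy E|have := sy F]; rewrite DP !inE eqxx ?orbT => /(_ isT)/andP[].
  by rewrite DP in_set2 inE => /orP[]/eqP->; rewrite ?Ee ?Fe.
move=> x P _; rewrite !inE => /andP[/subsetP sP cP]; rewrite cP !andbT.
have sPe : P \subset edges e by apply/subsetP=> E /sP; rewrite inE => /andP[].
rewrite sPe andbT /=; apply/trivIsetP=> tP.
have /cards2P[E [F [nEF DP]]] := cP.
have EP : E \in P by rewrite DP set21.
have FP : F \in P by rewrite DP set22.
have := sP _ EP; rewrite inE => /andP[_ xE]; have := sP _ FP; rewrite inE => /andP[_ xF].
by have := pred0P (tP _ _ EP FP nEF) x; rewrite /= xE xF.
Qed.

Lemma graph3_moved s x : graph_cycle e 3 s -> x \in moved s ->
  [/\ moved s = [set x; s x; s (s x)], x != s x, x != s (s x), s x != s (s x)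
    & s (s (s x)) = x].
Proof.
case/and3P=> gs cs /eqP s3 xs.
have nx : x != s x by move: xs; rewrite inE eq_sym.
have nsx : x != s (s x) by rewrite eq_sym cycle_period // s3.
have nssx : s x != s (s x) by rewrite (inj_eq perm_inj).
have sssx : s (s (s x)) = x.
  by have := iter_porbit s x; rewrite (is_cycle_porbit cs xs) s3.
split=> //; apply/esym/eqP; rewrite eqEcard s3; apply/andP; split.
  by rewrite !subUset !sub1set !moved_perm xs.
by rewrite setUC cardsU1 cards2 nx !inE negb_or eq_sym nsx eq_sym nssx.
Qed.

Lemma graph3_adjacent s x y : graph_cycle e 3 s ->
  x \in moved s -> y \in moved s -> x != y -> e x y.
Proof.
move=> gs xs ys nxy; have /and3P[/graph_permP sg _ _] := gs.
have [Dm n1 n2 n3 sss] := graph3_moved gs xs.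
move: ys nxy; rewrite Dm !inE -orbA => /or3P[]/eqP->; rewrite ?eqxx // => _.
  exact: sg.
by rewrite e_sym -{2}sss; apply: sg; rewrite !moved_perm.
Qed.

(** In the sum of the degrees, an edge which meets the triangle counts once, and
    once more if it is one of the three sides. *)
Lemma triangle_edges s : graph_cycle e 3 s ->
  (#|[set E : {set 'I_n} in edges e | [disjoint moved s & E]]| + \sum_(x in moved s) deg e x
    = #|edges e| + 3)%N.
Proof.
move=> gs; have /and3P[_ _ /eqP s3] := gs.
rewrite (sum_deg_in e_sym e_irr).
rewrite -[in RHS](cardsID [set E : {set 'I_n} | [disjoint moved s & E]] (edges e)).
rewrite -addnA; congr (_ + _)%N; first by apply: eq_card => E; rewrite in_setI !in_set.
have <- : #|[set E : {set 'I_n} in edges e | E \subset moved s]| = 3%N.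
  transitivity #|[set E : {set 'I_n} | E \subset moved s & #|E| == 2%N]|; last first.
    by rewrite cards_draws s3.
  apply: eq_card => E; rewrite [LHS]in_set [RHS]in_set [RHS]andbC.
  apply: andb_id2r => sE.
  apply/idP/eqP=> [|E2]; first exact: (card_edge e_irr).
  have /cards2P[x [y [nxy DE]]] : #|E| == 2%N by rewrite E2.
  rewrite DE edges_pair // (graph3_adjacent gs) ?(subsetP sE) ?DE ?set21 ?set22 //.
rewrite -[#|edges e :\: _|]sum1_card -[#|[set E in edges e | E \subset _]|]sum1_card.
rewrite big_mkcond [X in _ = (X + _)%N]big_mkcond [X in _ = (_ + X)%N]big_mkcond.
rewrite -big_split; apply: eq_bigr => E _ /=.
rewrite in_setD [E \in [set F in edges e | F \subset _]]in_set.
have [Ee|_] := boolP (E \in edges e); last by rewrite !andbF.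
rewrite in_set andbT; have E2 := card_edge e_irr Ee.
have := subset_leq_card (subsetIl E (moved s)); rewrite E2.
have -> : [disjoint moved s & E] = (#|E :&: moved s| == 0%N).
  by rewrite cards_eq0 setI_eq0 disjoint_sym.
have -> : (E \subset moved s) = (#|E :&: moved s| == 2%N).
  apply/setIidPl/eqP=> [->|E']; first by rewrite E2.
  by apply/eqP; rewrite eqEcard subsetIl E2 E'.
by case: #|_| => [|[|[|]]].
Qed.

End Counts.

(** * A triangle and a disjoint edge *)

Section Type32.
Variables (n : nat) (e : rel 'I_n).
Hypotheses (e_sym : symmetric e) (e_irr : irreflexive e).
Local Open Scope group_scope.
Local Open Scope ring_scope.
Implicit Types (s t a b : 'S_n) (x y z : 'I_n).

Lemma perm_on_moved s : perm_on (moved s) s.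
Proof. by apply/subsetP=> x; rewrite !inE. Qed.

Lemma moved_out s x : x \notin moved s -> s x = x.
Proof. by rewrite inE negbK => /eqP. Qed.

Definition graph_32 s := [&& graph_perm e s, #|moved s| == 5%N & ~~ is_cycle s].

Lemma mul_disjoint_moved a b x : [disjoint moved a & moved b] ->
  (a * b)%g x = if x \in moved a then a x else b x.
Proof.
move=> dab; rewrite permM; case: ifP => xa; last by rewrite (moved_out (negbT xa)).
by apply: moved_out; rewrite (disjointFr dab) // moved_perm.
Qed.

Lemma moved_mul_disjoint a b : [disjoint moved a & moved b] ->
  moved (a * b)%g = moved a :|: moved b.
Proof.
move=> dab; apply/setP=> x; rewrite in_setU inE mul_disjoint_moved //.
by case: ifP => xa; [move: xa; rewrite inE|rewrite inE].
Qed.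

Lemma cycle3_order a : is_cycle a -> #|moved a| = 3%N -> (a ^+ 3 = 1)%g.
Proof.
move=> ca a3; apply/permP=> x; rewrite perm1 permX.
have [xa|xa] := boolP (x \in moved a).
  by have := iter_porbit a x; rewrite is_cycle_porbit // a3.
by rewrite /= !(moved_out xa).
Qed.

Lemma graph_32_mul a b : graph_cycle e 3 a -> graph_invol e 1 b ->
  [disjoint moved a & moved b] -> graph_32 (a * b)%g.
Proof.
case/and3P=> /graph_permP ga ca /eqP a3 /and3P[/graph_permP gb _ /eqP b2] dab.
have mE := moved_mul_disjoint dab.
have m5 : #|moved (a * b)%g| = 5%N.
  by rewrite mE cardsU disjoint_setI0 // cards0 a3 b2.
apply/and3P; split; rewrite ?m5 //.
  apply/graph_permP=> x; rewrite mE inE mul_disjoint_moved //.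
  by case: ifP => [xa _|_ /= xb]; [apply: ga|apply: gb].
apply/negP=> cab; have /card_gt0P[x xa] : (0 < #|moved a|)%N by rewrite a3.
have xab : x \in moved (a * b)%g by rewrite mE inE xa.
have sa : (a * b)%g \in 'N(moved a | 'P).
  apply/astabsP=> y; rewrite /= /aperm mul_disjoint_moved //.
  case: ifP => ya; first by rewrite moved_perm ya.
  have [yb|/moved_out->] := boolP (y \in moved b); last by [].
  by rewrite (disjointFl dab) // moved_perm.
have := stable_porbit x sa; rewrite xa is_cycle_porbit // => /subset_leq_card.
by rewrite m5 a3.
Qed.

(** The two factors commute, and the first one is recovered as the fourth power
    of the product. *)
Lemma mul_disjoint_inj a b a' b' : (a ^+ 3 = 1)%g -> (b * b = 1)%g ->
  (a' ^+ 3 = 1)%g -> (b' * b' = 1)%g ->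
  [disjoint moved a & moved b] -> [disjoint moved a' & moved b'] ->
  (a * b = a' * b')%g -> a = a'.
Proof.
have pow4 (c d : 'S_n) : (c ^+ 3 = 1)%g -> (d * d = 1)%g -> [disjoint moved c & moved d] ->
   ((c * d) ^+ 4 = c)%g.
  move=> c3 d2 dcd; rewrite expgMn; last first.
    exact: (perm_onC (perm_on_moved c) (perm_on_moved d) dcd).
  by rewrite expgSr c3 mul1g (expgD d 2 2) expg2 d2 !mulg1.
move=> a3 b2 a3' b2' dab dab' E.
by rewrite -(pow4 a b) // E pow4.
Qed.

(** The factors are the restrictions of [s] to its two long orbits. *)
Lemma graph_32_split s : graph_32 s -> exists a b,
  [/\ graph_cycle e 3 a, graph_invol e 1 b, [disjoint moved a & moved b] & s = (a * b)%g].
Proof.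
case/and3P=> /graph_permP gs /eqP s5 ncs.
have [c [d [ncd DQ c3 d2]]] := orbits_32 s5 ncs.
have cQ : c \in long_orbits s by rewrite DQ set21.
have dQ : d \in long_orbits s by rewrite DQ set22.
have dcd : [disjoint c & d].
  by have /trivIsetP := trivIset_long_orbits s; apply.
have stab f : f \in long_orbits s -> s \in 'N(f | 'P).
  move=> fQ; rewrite -(_ : cover [set f] = f); last by rewrite /cover big_set1.
  by apply: cover_stable; rewrite sub1set; move: fQ; rewrite inE => /andP[].
have sub f : f \in long_orbits s -> f \subset moved s.
  by case/long_orbitsP=> x xs ->; apply: porbit_moved.
have restrE f x : f \in long_orbits s -> restr_perm f s x = if x \in f then s x else x.
  move=> fQ; case: ifP => xf; first by rewrite restr_permE ?stab.
  by rewrite (out_perm (restr_perm_on _ _)) // xf.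
have mf f : f \in long_orbits s -> moved (restr_perm f s) = f.
  move=> fQ; apply/setP=> x; rewrite inE restrE //; case: ifP => xf; last by rewrite eqxx.
  by have := subsetP (sub f fQ) x xf; rewrite inE.
have gf f : f \in long_orbits s -> graph_perm e (restr_perm f s).
  move=> fQ; apply/graph_permP=> x; rewrite mf // => xf; rewrite restrE // xf.
  by apply: gs; apply: (subsetP (sub f fQ)).
have dm : [disjoint moved (restr_perm c s) & moved (restr_perm d s)] by rewrite !mf.
exists (restr_perm c s), (restr_perm d s); split=> //.
- by rewrite /graph_cycle gf // mf // c3 eqxx andbT; apply: small_cycle; rewrite mf // c3.
- rewrite /graph_invol gf // mf // d2 eqxx andbT; apply/eqP/orbits2_invol => x.
  move=> xd; rewrite is_cycle_porbit //; first by rewrite mf.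
  by apply: small_cycle; rewrite mf // d2.
apply/permP=> x; rewrite mul_disjoint_moved // mf // !restrE //.
case xc: (x \in c) => //; case xd: (x \in d) => //; apply: moved_out.
by rewrite -cover_long_orbits DQ /cover big_setU1 ?in_set1 // big_set1 in_setU xc xd.
Qed.

Lemma card_graph_32 :
  (#|[set s | graph_32 s]|
    = 2 * \sum_(C in cycles e 3)
            #|[set E : {set 'I_n} in edges e | [disjoint cover C & E]]|)%N.
Proof.
(* [Q] is the type of the two factors of the elements of [graph_32]. *)
pose Q (u : 'S_n * 'S_n) :=
  [&& graph_cycle e 3 u.1, graph_invol e 1 u.2 & [disjoint moved u.1 & moved u.2]].
have -> : [set s | graph_32 s] = (fun u => (u.1 * u.2)%g) @: [set u | Q u].
  apply/setP=> s; rewrite inE; apply/idP/imsetP=> [/graph_32_split[a [b [aP bP dab ->]]]|].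
    by exists (a, b); rewrite // inE /Q /= aP bP.
  by case=> [[a b]]; rewrite inE /Q /= => /and3P[aP bP dab] ->; apply: graph_32_mul.
rewrite card_in_imset; last first.
  move=> [a b] [a' b']; rewrite !inE /Q /=.
  move=> /and3P[/and3P[_ ca /eqP a3] /and3P[_ /eqP b2 _] dab].
  move=> /and3P[/and3P[_ ca' /eqP a3'] /and3P[_ /eqP b2' _] dab'] E.
  have Ea : a = a' by apply: (mul_disjoint_inj _ b2 _ b2') E; rewrite ?cycle3_order.
  by rewrite Ea in E *; rewrite (mulgI _ _ _ E).
rewrite cardsE -sum1_card.
rewrite (eq_bigl (fun u : 'S_n * 'S_n => graph_cycle e 3 u.1
  && (graph_invol e 1 u.2 && [disjoint moved u.1 & moved u.2]))) //.
rewrite -(pair_big_dep (graph_cycle e 3)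
  (fun a b => graph_invol e 1 b && [disjoint moved a & moved b]) (fun _ _ => 1%N)) /=.
rewrite mul2n -addnn.
apply: (etrans _ (sum_graph_cycles e_sym e_irr
  (fun A => #|[set E : {set 'I_n} in edges e | [disjoint A & E]]|) (isT : 2 < 3)%N)).
apply: eq_bigr => a _; rewrite -sum1_card big_mkcondr /=.
rewrite (@sum_graph_invol n e e_sym e_irr nat
  (fun B => if [disjoint moved a & B] then 1 else 0)%N).
rewrite (@sum_matchings1 n e nat
  (fun B => if [disjoint moved a & B] then 1 else 0)%N).
rewrite -big_mkcondr; by apply: eq_bigl => E; rewrite [RHS]in_set.
Qed.

End Type32.

(** * Coefficients of the immanantal polynomial *)

Section ElemSym.
Local Open Scope ring_scope.

(** Vieta's formula, indexed from the leading coefficient downwards. *)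
Lemma coef_prod_XsubC (R : comNzRingType) (a : R) (ds : seq nat) q : (q <= size ds)%N ->
  (\prod_(d <- ds) ('X - (a * d%:R)%:P))`_(size ds - q)
    = (- a) ^+ q * (elem_sym q ds)%:R.
Proof.
move=> le_q; set N := size ds.
rewrite (big_nth 0%N) big_mkord -/N.
under eq_bigr do rewrite addrC.
rewrite bigA_distr /= coef_sum /elem_sym natr_sum mulr_sumr [RHS]big_mkcond /=.
apply: eq_bigr => A _.
have -> : \prod_(i < N) (if i \in A then - (a * (nth 0%N ds i)%:R)%:P else 'X)
    = (\prod_(i in A) (- a * (nth 0%N ds i)%:R))%:P * 'X^#|[predC A]|.
  rewrite (bigID (mem A)) /= -prodr_const rmorph_prod; congr (_ * _).
    by apply: eq_bigr => i ->; rewrite -polyCN -mulNr.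
  by apply: eq_bigr => i /negPf->.
rewrite coefCM coefXn big_split prodr_const /=.
have -> : #|[predC A]| = (N - #|A|)%N.
  have cN := cardC A; rewrite card_ord in cN; apply: (@addnI #|A|); rewrite cN subnKC //.
  by have := max_card A; rewrite card_ord.
have -> : ((N - q == N - #|A|) = (#|A| == q))%N.
  by have := max_card A; rewrite card_ord => leA; apply/eqP/eqP; lia.
rewrite -/N natr_prod; case: eqP => [->|_]; rewrite ?mulr1 ?mulr0 //.
Qed.

Lemma elem_sym0 ds : elem_sym 0 ds = 1%N.
Proof.
rewrite /elem_sym (big_pred1 set0) ?big_set0 // => A.
by rewrite cards_eq0.
Qed.

Lemma elem_sym1 ds : elem_sym 1 ds = sumn ds.
Proof.
rewrite sumnE (big_nth 0%N) big_mkord /elem_sym.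
have E : forall A : {set 'I_(size ds)}, (#|A| == 1%N) = (A \in set1 @: [set: 'I_(size ds)]).
  move=> A; apply/cards1P/imsetP=> [[i ->]|[i _ ->]]; by exists i.
rewrite (eq_bigl _ _ E) big_imset /=; last by move=> i j _ _; apply: set1_inj.
by apply: eq_big => i; rewrite ?inE // big_set1.
Qed.

End ElemSym.

Section Coefs.
Variables (R : comNzRingType) (n : nat) (e : rel 'I_n) (alpha : R) (la : seq nat).
Hypotheses (e_irr : irreflexive e).
Local Open Scope ring_scope.
Implicit Types (s : 'S_n).

(** [degs_off (cover C)] is [deg_seq_off e C]; here the set of vertices to be
    left out will be the set of moved points. *)
Definition degs_off (A : {set 'I_n}) : seq nat := [seq deg e i | i <- enum (~: A)].

Lemma size_degs_off A : size (degs_off A) = (n - #|A|)%N.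
Proof. by rewrite size_map -cardE [LHS]cardsCs setCK card_ord. Qed.

(** The contribution of the fixed points of a permutation whose moved points form
    [A]. *)
Definition degs_off_poly A : {poly R} := \prod_(d <- degs_off A) ('X - (alpha * d%:R)%:P).

Lemma size_degs_off_poly A : size (degs_off_poly A) = (n - #|A|).+1.
Proof. by rewrite /degs_off_poly size_prod_XsubC size_degs_off. Qed.

Lemma prod_char_poly_mx s :
  \prod_(i < n) char_poly_mx (Aalpha e alpha) i (s i)
    = (if graph_perm e s then (- (1 - alpha)) ^+ #|moved s| else 0) *: degs_off_poly (moved s).
Proof.
have entry i : char_poly_mx (Aalpha e alpha) i (s i)
    = if i \in moved s then (- (1 - alpha) * (e i (s i))%:R)%:P
      else 'X - (alpha * (deg e i)%:R)%:P.
  rewrite /char_poly_mx !mxE inE [s i == _]eq_sym; case: eqP => [<-|_] /=.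
    by rewrite e_irr mulr0 addr0 !mulr1n.
  by rewrite !mulr0n mulr0 !add0r mulNr polyCN.
rewrite (eq_bigr _ (fun i _ => entry i)) (bigID (mem (moved s))) /=.
rewrite (eq_bigr (fun i => (- (1 - alpha) * (e i (s i))%:R)%:P)); last by move=> i ->.
rewrite -rmorph_prod big_split prodr_const /= mul_polyC; congr (_ *: _).
  case: ifPn => [/graph_permP gs|/forall_inPn[i im /negPf nei]].
    by rewrite big1 ?mulr1 // => i im; rewrite gs.
  by rewrite (bigD1 i) //= nei mul0r mulr0.
rewrite /degs_off_poly /degs_off big_map big_enum /=.
by apply: eq_big => [i|i /negPf->] //; rewrite in_setC.
Qed.

Lemma imm_polyE :
  imm_poly la (Aalpha e alpha) =
    \sum_(s : 'S_n | graph_perm e s)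
      ((sym_chi_int la s)%:~R * (- (1 - alpha)) ^+ #|moved s|) *: degs_off_poly (moved s).
Proof.
rewrite /imm_poly /immanant [RHS]big_mkcond; apply: eq_bigr => s _.
rewrite prod_char_poly_mx -[_%:~R]/(_) -(rmorph_int (@polyC R)) mul_polyC scalerA.
by case: ifP; rewrite // mulr0 scale0r.
Qed.

Lemma imm_poly_coefs :
  imm_poly la (Aalpha e alpha)
    = \sum_(r < n.+1) ((-1) ^+ r * imm_coef la (Aalpha e alpha) r) *: 'X^(n - r).
Proof.
set p := imm_poly _ _.
have szp : (size p <= n.+1)%N.
  rewrite /p imm_polyE; apply: leq_trans (size_sum _ _ _) _; apply/bigmax_leqP=> s _.
  by rewrite (leq_trans (size_scale_leq _ _)) // size_degs_off_poly ltnS leq_subr.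
have -> : p = \poly_(i < n.+1) p`_i.
  apply/polyP=> i; rewrite coef_poly; case: ltnP => // le_ni.
  by rewrite nth_default // (leq_trans szp).
(* [r] and [n - r] are exchanged by [rev_ord]. *)
rewrite poly_def (reindex_inj rev_ord_inj) /=; apply: eq_bigr => r _.
by rewrite /imm_coef -/p subSS mulrA -exprD addnn -mul2n exprM sqrrN !expr1n mul1r.
Qed.

(** The part of [c_r] which comes from the permutations with [p] moved points,
    up to the powers of [alpha] and [1 - alpha]. *)
Definition type_sum p r : R :=
  \sum_(s : 'S_n | graph_perm e s && (#|moved s| == p))
     (sym_chi_int la s)%:~R * (elem_sym (r - p) (degs_off (moved s)))%:R.

(** The number of signs is [r] from the definition of the coefficient, [p] from
    the moved points and [r - p] from Vieta's formula, so they cancel. *)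
Lemma imm_coefE r : (r <= n)%N ->
  imm_coef la (Aalpha e alpha) r
    = \sum_(p < r.+1) (1 - alpha) ^+ p * alpha ^+ (r - p) * type_sum p r.
Proof.
move=> le_rn; rewrite /imm_coef imm_polyE coef_sum mulr_sumr.
rewrite (bigID (fun s : 'S_n => (#|moved s| <= r)%N)) /= [X in _ + X]big1 ?addr0; last first.
  move=> s /andP[_]; rewrite -ltnNge => lt_r.
  rewrite coefZ nth_default ?mulr0 // size_degs_off_poly.
  have len : (#|moved s| <= n)%N by have := max_card (moved s); rewrite card_ord.
  by apply: ltn_sub2l => //; apply: leq_trans lt_r len.
rewrite (partition_big (fun s : 'S_n => inord #|moved s| : 'I_r.+1) predT) //=.
apply: eq_bigr => p _; rewrite /type_sum mulr_sumr.
have pE s : (#|moved s| <= r)%N && (inord #|moved s| == p) = (#|moved s| == p :> nat).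
  have le_pr : (p <= r)%N by rewrite -ltnS.
  apply/andP/eqP => [[le_r /eqP <-]|E]; first by rewrite inordK ?ltnS.
  by rewrite E le_pr inord_val.
apply: eq_big => [s|s /andP[/andP[_ le_r] /eqP Dp]]; first by rewrite -andbA pE.
have -> : (p : nat) = #|moved s| by rewrite -Dp inordK ?ltnS.
have len := max_card (moved s); rewrite card_ord in len.
have -> : (n - r = size (degs_off (moved s)) - (r - #|moved s|))%N.
  by rewrite size_degs_off -subnDA subnKC.
rewrite coefZ coef_prod_XsubC ?size_degs_off ?leq_sub2r //.
have -> : (-1) ^+ r = (-1) ^+ #|moved s| * (-1) ^+ (r - #|moved s|) :> R.
  by rewrite -exprD subnKC.
set q := (r - _)%N; set m := #|moved s|.
rewrite !(exprNn (1 - alpha)) !(exprNn alpha).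
set u := _%:~R; set v := (elem_sym _ _)%:R.
have sg (j : nat) : (-1) ^+ j * (-1) ^+ j = 1 :> R by rewrite -exprMn mulrNN mulr1 expr1n.
transitivity (((-1) ^+ m * (-1) ^+ m) * ((-1) ^+ q * (-1) ^+ q)
  * ((1 - alpha) ^+ m * alpha ^+ q * (u * v))); first by ring.
by rewrite !sg !mul1r.
Qed.

End Coefs.

(** * Values of the hook characters *)

Section Values.
Variables (R : realFieldType) (n k : nat).
Hypothesis k_hook : (0 < k <= n)%N.
Local Open Scope ring_scope.
Implicit Types (s : 'S_n).
Local Notation B := (@binz R).

Lemma coef_1X N j : ((1 + 'X) ^+ N : {poly int})`_j = 'C(N, j)%:R.
Proof.
rewrite exprDn (eq_bigr (fun i : 'I_N.+1 => ('C(N, i)%:R : int) *: 'X^i)); last first.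
  by move=> i _; rewrite expr1n mul1r scaler_nat.
rewrite -(poly_def N.+1 (fun i => 'C(N, i)%:R : int)) coef_poly ltnS.
by case: leqP => // /bin_small->.
Qed.

(** The symmetry of the binomial coefficients turns the lower index [n - k - i]
    into [k - q]; when one of the two is negative, the other exceeds the upper
    index. *)
Lemma coef_Xn1X p i q : (p < n)%N -> (i + q = p.+1)%N -> (0 < q)%N ->
  (('X^i * (1 + 'X) ^+ (n - p.+1) : {poly int})`_(n - k))%:~R = B (n - p.+1) (k%:Z - q%:Z).
Proof.
move=> ltpn Dp q0; have /andP[k0 le_kn] := k_hook.
rewrite coefXnM; case: ltnP => [lt_i|le_i].
  have -> : k%:Z - q%:Z = (k - q)%N%:Z by rewrite subzn //; lia.
  by rewrite /= bin_small //; lia.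
rewrite coef_1X rmorph_nat; have [le_qk|lt_kq] := leqP q k.
  have -> : k%:Z - q%:Z = (k - q)%N%:Z by rewrite subzn.
  rewrite /= -bin_sub; last by lia.
  by congr ('C(_, _)%:R); lia.
rewrite bin_small; last by lia.
have -> : k%:Z - q%:Z = - (q - k)%N%:Z by rewrite -subzn ?opprB // ltnW.
have : (0 < q - k)%N by rewrite subn_gt0. case: (q - k)%N => // m _; rewrite -NegzE.
Qed.

(** The value of the hook character as it enters the immanant. *)
Definition hook_val s : R := (sym_chi_int (hook_part n k) s)%:~R.

Lemma hook_valE s p (P : {poly int}) : (p < n)%N ->
  cycle_poly s = (1 + 'X) ^+ (#|'I_n| - p) * P ->
  hook_val s = ((P * (1 + 'X) ^+ (n - p.+1))`_(n - k))%:~R.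
Proof.
move=> ltpn Ds; rewrite /hook_val (@sym_chi_int_hook n k s ((1 + 'X) ^+ (n - p.+1) * P)) //.
  by rewrite mulrC.
by rewrite Ds card_ord -subSS subSn // exprS mulrA.
Qed.

Lemma hook_val1 : hook_val 1 = B (n - 1) (k%:Z - 1).
Proof.
have n0 : (0 < n)%N by lia.
rewrite (@hook_valE _ 0 1) //; last first.
  have m0 : moved (1%g : 'S_n) = set0 by apply/eqP; rewrite -cards_eq0 moved_eq0.
  rewrite cycle_poly_long m0 cards0 big1 // => c /long_orbitsP[x].
  by rewrite m0 inE.
by rewrite -(@coef_Xn1X 0 0 1) // expr0.
Qed.

(** The factor 1 + X of 1 - X^2 is absorbed in the power of 1 + X; this is why the
    upper index is [n - 2] and not [n - 3]. *)
Lemma hook_val2 s : (2 < n)%N -> #|moved s| = 2%N ->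
  hook_val s = B (n - 2) (k%:Z - 2) - B (n - 2) (k%:Z - 1).
Proof.
move=> n2 s2; have cs : is_cycle s by apply: small_cycle; rewrite s2.
rewrite (@hook_valE _ 1 (1 - 'X)) ?(ltnW n2) //; last first.
  rewrite cycle_poly_cycle ?s2 // card_ord.
  have -> : (n - 1 = (n - 2).+1)%N by lia.
  by rewrite sqrrN (exprSr (1 + 'X)) -mulrA; congr (_ * _); ring.
rewrite -(@coef_Xn1X 1 0 2) ?(ltnW n2) // -(@coef_Xn1X 1 1 1) ?(ltnW n2) //.
by rewrite -rmorphB -coefB expr0 expr1 mulrBl.
Qed.

Lemma hook_val_cycle s p : (1 < p < n)%N -> is_cycle s -> #|moved s| = p ->
  hook_val s = B (n - p.+1) (k%:Z - p.+1%:Z) - (-1) ^+ p * B (n - p.+1) (k%:Z - 1).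
Proof.
move=> /andP[p1 ltpn] cs sp.
have := cycle_poly_cycle cs; rewrite sp => /(_ p1) Ds; rewrite (hook_valE ltpn Ds).
rewrite -(@coef_Xn1X p 0 p.+1) // -(@coef_Xn1X p p 1) ?addn1 //.
rewrite expr0 (exprNn 'X) mulrBl coefB rmorphB /=; congr (_ - _).
rewrite -mulrA -signr_odd -[in RHS]signr_odd; case: (odd p).
  by rewrite ?expr1 !mulN1r coefN rmorphN.
by rewrite ?expr0 !mul1r.
Qed.

Lemma hook_val22 s : (4 < n)%N -> (s * s = 1)%g -> #|moved s| = 4%N ->
  hook_val s = B (n - 5) (k%:Z - 5) - 2 * B (n - 5) (k%:Z - 3) + B (n - 5) (k%:Z - 1).
Proof.
move=> n4 ss s4; rewrite (hook_valE n4 (cycle_poly_22 s4 ss)).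
rewrite -(@coef_Xn1X 4 0 5) // -(@coef_Xn1X 4 2 3) // -(@coef_Xn1X 4 4 1) //.
have -> : (1 - 'X^2) * (1 - 'X^2) * (1 + 'X) ^+ (n - 5)
    = 'X^0 * (1 + 'X) ^+ (n - 5) - 'X^2 * (1 + 'X) ^+ (n - 5) *+ 2
        + 'X^4 * (1 + 'X) ^+ (n - 5) :> {poly int} by ring.
by rewrite !(coefD, coefN, coefMn) !(rmorphD, rmorphN, rmorphMn) /= mulr_natl.
Qed.

Lemma hook_val32 s : (5 < n)%N -> ~~ is_cycle s -> #|moved s| = 5%N ->
  hook_val s = B (n - 6) (k%:Z - 6) + B (n - 6) (k%:Z - 3)
                 - B (n - 6) (k%:Z - 4) - B (n - 6) (k%:Z - 1).
Proof.
move=> n5 ncs s5; rewrite (hook_valE n5 (cycle_poly_32 s5 ncs)).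
rewrite -(@coef_Xn1X 5 0 6) // -(@coef_Xn1X 5 3 3) //.
rewrite -(@coef_Xn1X 5 2 4) // -(@coef_Xn1X 5 5 1) //.
have -> : (1 + 'X^3) * (1 - 'X^2) * (1 + 'X) ^+ (n - 6)
    = 'X^0 * (1 + 'X) ^+ (n - 6) + 'X^3 * (1 + 'X) ^+ (n - 6)
        - 'X^2 * (1 + 'X) ^+ (n - 6) - 'X^5 * (1 + 'X) ^+ (n - 6) :> {poly int} by ring.
by rewrite !(coefD, coefN) !(rmorphD, rmorphN).
Qed.

(** This is (k-1) C(n-2, k-1) = (n-k) C(n-2, k-2), divided by k - 1.  For k = 1
    both sides are -1 by the convention for [binz_quot]. *)
Lemma binz_quotE : (2 < n)%N ->
  (2 * k%:R - n%:R - 1) * binz_quot R n k = B (n - 2) (k%:Z - 2) - B (n - 2) (k%:Z - 1).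
Proof.
move=> n2; have /andP[k0 le_kn] := k_hook; rewrite /binz_quot.
case: k k0 le_kn => // j _ lejn; rewrite eqSS.
have Ej1 : j.+1%:Z - 1 = j%:Z by rewrite -addn1 PoszD addrK.
case: j lejn Ej1 => [|j] lejn Ej1.
  rewrite Ej1 eqxx /= bin0 sub0r; have nz : n%:R - 1 != 0 :> R.
    by rewrite subr_eq0 pnatr_eq1; lia.
  by rewrite -[RHS]mulN1r; field.
have -> : j.+2%:Z - 2 = j%:Z by rewrite -addn2 PoszD addrK.
rewrite Ej1 [_ == _]/= [B _ j]/= [B _ j.+1]/=.
have := mul_bin_left (n - 2) j => /(congr1 (fun m => m%:R : R)).
rewrite !natrM => H.
have nz : j.+2%:R - 1 != 0 :> R by rewrite subr_eq0 pnatr_eq1.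
apply: (mulIf nz); rewrite mulrA mulfVK //.
have E1 : j.+2%:R = j.+1%:R + 1 :> R by rewrite -addn1 natrD.
have E2 : (n - 2 - j)%:R = n%:R - j.+1%:R - 1 :> R.
  have nE : n = ((n - 2 - j) + j.+1 + 1)%N by lia.
  by rewrite [X in _ = X%:R - _ - _]nE !natrD; ring.
rewrite E2 in H; rewrite E1 addrK [RHS]mulrBl ['C(_, j.+1)%:R * _]mulrC H; ring.
Qed.

End Values.

(** * Sums over the permutations with a given number of moved points *)

Section TypeSums.
Variables (R : realFieldType) (n k : nat) (e : rel 'I_n).
Hypotheses (e_sym : symmetric e) (e_irr : irreflexive e).
Hypothesis k_hook : (0 < k <= n)%N.
Local Open Scope ring_scope.
Implicit Types (s : 'S_n).
Local Notation B := (@binz R).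
Local Notation tsum := (type_sum R e (hook_part n k)).

Lemma type_sum_const (P : pred 'S_n) p r (x : R) :
  (forall s, graph_perm e s && (#|moved s| == p) = P s) ->
  (forall s, P s -> hook_val R k s = x) ->
  tsum p r = x * \sum_(s | P s) (elem_sym (r - p) (degs_off e (moved s)))%:R.
Proof.
move=> PE xE; rewrite /type_sum mulr_sumr.
by apply: eq_big => // s; rewrite PE => /xE <-.
Qed.

Lemma type_sum0 r : tsum 0 r = B (n - 1) (k%:Z - 1) * (Fdeg e r)%:R.
Proof.
rewrite (@type_sum_const (pred1 1%g) _ _ (hook_val R k (1%g : 'S_n))).
- rewrite hook_val1 // big_pred1_eq subn0; congr (_ * (elem_sym _ _)%:R).
  rewrite /degs_off /deg_seq; congr map; apply: eq_enum => x.
  by rewrite !inE perm1 eqxx.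
- move=> s; rewrite moved_eq0 /=; apply: andb_idl => /eqP->.
  by apply/graph_permP=> x; rewrite inE perm1 eqxx.
by move=> s /eqP->.
Qed.

Lemma type_sum1 r : tsum 1 r = 0.
Proof.
by rewrite /type_sum big1 // => s /andP[_]; rewrite (negPf (moved_small s)).
Qed.

Lemma type_sum2 r : (2 < n)%N ->
  tsum 2 r = (B (n - 2) (k%:Z - 2) - B (n - 2) (k%:Z - 1)) * (matching_sum e r 1)%:R.
Proof.
move=> n2; rewrite (type_sum_const (P := graph_invol e 1) r
  (x := B (n - 2) (k%:Z - 2) - B (n - 2) (k%:Z - 1))).
- congr (_ * _); rewrite (sum_graph_invol e_sym e_irr
    (fun A => (elem_sym (r - 2) (degs_off e A))%:R : R)).
  by rewrite /matching_sum natr_sum.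
- move=> s; rewrite /graph_invol; congr (_ && _); apply/esym/andb_idl => /eqP s2.
  apply/eqP/orbits2_invol => x xs.
  by rewrite is_cycle_porbit // small_cycle // s2.
by move=> s /and3P[_ _ /eqP s2]; apply: hook_val2.
Qed.

Lemma sum_cycle_sum l r : (2 < l)%N ->
  \sum_(s | graph_cycle e l s) (elem_sym (r - l) (degs_off e (moved s)))%:R
    = 2 * (cycle_sum e r l)%:R :> R.
Proof.
move=> l2; rewrite (sum_graph_cycles e_sym e_irr
  (fun A => (elem_sym (r - l) (degs_off e A))%:R : R)) //.
by rewrite -[LHS]mulr_natl /cycle_sum natr_sum.
Qed.

Lemma type_sum3 r : (3 < n)%N ->
  tsum 3 r = (B (n - 4) (k%:Z - 4) + B (n - 4) (k%:Z - 1)) * (2 * (cycle_sum e r 3)%:R).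
Proof.
move=> n3; rewrite -sum_cycle_sum //; apply: (type_sum_const (P := graph_cycle e 3)) => s.
  rewrite /graph_cycle; congr (_ && _); apply/esym/andb_idl => /eqP s3.
  by apply: small_cycle; rewrite s3.
by case/and3P=> _ cs /eqP s3; rewrite (hook_val_cycle R k_hook _ cs s3) //; ring.
Qed.

(** The second sum is over involutions for p = 4, and over products of a triangle
    and an edge for p = 5. *)
Lemma type_sum_split p r :
  tsum p r = \sum_(s | graph_cycle e p s)
         hook_val R k s * (elem_sym (r - p) (degs_off e (moved s)))%:R
    + \sum_(s | [&& graph_perm e s, ~~ is_cycle s & #|moved s| == p])
         hook_val R k s * (elem_sym (r - p) (degs_off e (moved s)))%:R.
Proof.
rewrite /type_sum (bigID (fun s => is_cycle s)) /=.
by congr (_ + _); apply: eq_bigl => s; rewrite -andbA [(_ == p) && _]andbC.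
Qed.

Lemma type_sum4 r : (4 < n)%N ->
  tsum 4 r = (B (n - 5) (k%:Z - 5) - B (n - 5) (k%:Z - 1)) * (2 * (cycle_sum e r 4)%:R)
    + (B (n - 5) (k%:Z - 5) - 2 * B (n - 5) (k%:Z - 3) + B (n - 5) (k%:Z - 1))
        * (matching_sum e r 2)%:R.
Proof.
move=> n4; rewrite type_sum_split; congr (_ + _).
  rewrite -sum_cycle_sum // mulr_sumr; apply: eq_bigr => s /and3P[_ cs /eqP s4].
  by rewrite (hook_val_cycle R k_hook _ cs s4) //; ring.
rewrite /matching_sum natr_sum.
rewrite -(sum_graph_invol e_sym e_irr
  (fun A => (elem_sym (r - 4) (degs_off e A))%:R : R)) mulr_sumr.
apply: eq_big => [s|s /and3P[_ ncs /eqP s4]].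
  rewrite /graph_invol; congr (_ && _); apply: andb_id2r => /eqP s4.
  by rewrite invol4.
by rewrite hook_val22 //; apply/eqP; rewrite invol4.
Qed.

Lemma type_sum5 : (5 < n)%N ->
  tsum 5 5 = (B (n - 6) (k%:Z - 6) + B (n - 6) (k%:Z - 1)) * (2 * (cycle_sum e 5 5)%:R)
    + (B (n - 6) (k%:Z - 6) + B (n - 6) (k%:Z - 3)
         - B (n - 6) (k%:Z - 4) - B (n - 6) (k%:Z - 1))
       * \sum_(C in cycles e 3) 2 * (#|edges e|%:R + 3 - (triangle_deg e C)%:R).
Proof.
move=> n5; rewrite type_sum_split; congr (_ + _).
  rewrite -sum_cycle_sum // mulr_sumr; apply: eq_bigr => s /and3P[_ cs /eqP s5].
  by rewrite (hook_val_cycle R k_hook _ cs s5) //; ring.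
transitivity ((B (n - 6) (k%:Z - 6) + B (n - 6) (k%:Z - 3)
         - B (n - 6) (k%:Z - 4) - B (n - 6) (k%:Z - 1)) * (#|[set s | graph_32 e s]|)%:R).
  rewrite -sum1_card natr_sum mulr_sumr; apply: eq_big => [s|s /and3P[_ ncs /eqP s5]].
    by rewrite inE /graph_32; congr (_ && _); rewrite andbC.
  by rewrite hook_val32 // subnn elem_sym0.
congr (_ * _); rewrite (card_graph_32 e_sym e_irr) natrM natr_sum mulr_sumr.
apply: eq_bigr => C /(cycles_edge_set e_irr (isT : 2 < 3)%N)[s gs <-].
rewrite /triangle_deg cover_edge_set; congr (_ * _).
apply/eqP; rewrite eq_sym subr_eq -!natrD; apply/eqP; congr (_%:R).
by rewrite (triangle_edges e_sym e_irr gs).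
Qed.

Lemma Fdeg1 : Fdeg e 1 = (2 * #|edges e|)%N.
Proof.
by rewrite /Fdeg elem_sym1 -(handshake e_sym e_irr) sumnE big_map big_enum.
Qed.

Lemma matching_sum_top l : matching_sum e (2 * l) l = #|matchings e l|.
Proof.
by rewrite /matching_sum subnn -sum1_card; apply: eq_bigr => M _; rewrite elem_sym0.
Qed.

Lemma matching_sum21 : matching_sum e 2 1 = #|edges e|.
Proof.
rewrite (matching_sum_top 1) -!sum1_card.
exact: (sum_matchings1 e (fun=> 1%N)).
Qed.

Lemma cycle_sum_top l : cycle_sum e l l = #|cycles e l|.
Proof.
by rewrite /cycle_sum subnn -sum1_card; apply: eq_bigr => M _; rewrite elem_sym0.
Qed.

End TypeSums.

Theorem corollary6p6 (R : realFieldType) (n k : nat) (e : rel 'I_n)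
    (alpha : R)
    (e_sym : symmetric e) (e_irr : irreflexive e)
    (alpha01 : 0 <= alpha <= 1)
    (k_hook : (1 <= k <= n)%N) :
  let c := imm_coef (hook_part n k) (Aalpha e alpha) in
  let m : R := #|edges e|%:R in
  let B := binz R in
  let kz : int := k%:Z in
  let t : R := 2 * k%:R - n%:R - 1 in
  [/\ imm_poly (hook_part n k) (Aalpha e alpha)
        = \sum_(r < n.+1) ((-1) ^+ r * c r) *: 'X^(n - r),
      c 0%N = B (n - 1)%N (kz - 1) /\
      c 1%N = 2 * m * alpha * B (n - 1)%N (kz - 1),
      (3 <= n)%N ->
      c 2%N = alpha ^+ 2 * (Fdeg e 2)%:R * B (n - 1)%N (kz - 1)
            + t * m * (1 - alpha) ^+ 2 * binz_quot R n k,
      (4 <= n)%N ->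
      c 3%N = alpha ^+ 3 * (Fdeg e 3)%:R * B (n - 1)%N (kz - 1)
            + t * alpha * (1 - alpha) ^+ 2 * (matching_sum e 3 1)%:R
                * binz_quot R n k
            + 2 * #|cycles e 3|%:R * (1 - alpha) ^+ 3
                * (B (n - 4)%N (kz - 4) + B (n - 4)%N (kz - 1))
    & ((5 <= n)%N ->
       c 4%N = alpha ^+ 4 * (Fdeg e 4)%:R * B (n - 1)%N (kz - 1)
            + t * alpha ^+ 2 * (1 - alpha) ^+ 2 * (matching_sum e 4 1)%:R
                * binz_quot R n k
            + 2 * alpha * (1 - alpha) ^+ 3 * (cycle_sum e 4 3)%:R
                * (B (n - 4)%N (kz - 4) + B (n - 4)%N (kz - 1))
            + 2 * #|cycles e 4|%:R * (1 - alpha) ^+ 4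
                * (B (n - 5)%N (kz - 5) - B (n - 5)%N (kz - 1))
            + ('C(#|edges e|, 2)%:R - \sum_(i < n) 'C(deg e i, 2)%:R)
                * (B (n - 5)%N (kz - 5) - 2 * B (n - 5)%N (kz - 3)
                   + B (n - 5)%N (kz - 1))
                * (1 - alpha) ^+ 4)
      /\
      ((6 <= n)%N ->
       c 5%N = alpha ^+ 5 * (Fdeg e 5)%:R * B (n - 1)%N (kz - 1)
            + t * alpha ^+ 3 * (1 - alpha) ^+ 2 * (matching_sum e 5 1)%:R
                * binz_quot R n k
            + 2 * alpha ^+ 2 * (1 - alpha) ^+ 3 * (cycle_sum e 5 3)%:R
                * (B (n - 4)%N (kz - 4) + B (n - 4)%N (kz - 1))
            + 2 * alpha * (1 - alpha) ^+ 4 * (cycle_sum e 5 4)%:R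
                * (B (n - 5)%N (kz - 5) - B (n - 5)%N (kz - 1))
            + alpha * (1 - alpha) ^+ 4 * (matching_sum e 5 2)%:R
                * (B (n - 5)%N (kz - 5) - 2 * B (n - 5)%N (kz - 3)
                   + B (n - 5)%N (kz - 1))
            + 2 * #|cycles e 5|%:R * (1 - alpha) ^+ 5
                * (B (n - 6)%N (kz - 6) + B (n - 6)%N (kz - 1))
            + \sum_(C in cycles e 3)
                2 * (m + 3 - (triangle_deg e C)%:R) * (1 - alpha) ^+ 5
                * (B (n - 6)%N (kz - 6) + B (n - 6)%N (kz - 3)
                   - B (n - 6)%N (kz - 4) - B (n - 6)%N (kz - 1)))].
Proof.
move=> c m B kz t; have n0 : (0 < n)%N by lia.
have cE r : (r <= n)%N -> c r = \sum_(p < r.+1)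
    (1 - alpha) ^+ p * alpha ^+ (r - p) * type_sum R e (hook_part n k) p r.
  exact: imm_coefE.
have tE : (2 < n)%N -> B (n - 2)%N (kz - 2) - B (n - 2)%N (kz - 1) = t * binz_quot R n k.
  by move=> n2; rewrite binz_quotE.
split.
- exact: imm_poly_coefs.
- split; first by rewrite cE // big_ord1 /= type_sum0 // /Fdeg elem_sym0 /B /kz subn0; ring.
  by rewrite cE // !big_ord_recl big_ord0 /= type_sum0 // type_sum1 Fdeg1 // natrM /B /kz /m; ring.
- move=> n2; rewrite cE; last by lia.
  rewrite !big_ord_recl big_ord0 /= /bump /= type_sum0 // type_sum1 type_sum2 // tE //.
  by rewrite matching_sum21 // /B /kz /m; ring.
- move=> n3; rewrite cE; last by lia.
  rewrite !big_ord_recl big_ord0 /= /bump /= type_sum0 // type_sum1 type_sum2 // ?tE; try lia.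
  by rewrite type_sum3 // cycle_sum_top /B /kz; ring.
split=> [n4|n5].
  rewrite cE; last by lia.
  rewrite !big_ord_recl big_ord0 /= /bump /= type_sum0 // type_sum1 type_sum2 // ?tE; try lia.
  rewrite type_sum3 // ?type_sum4 // ?cycle_sum_top; try lia.
  have -> : matching_sum e 4 2 = #|matchings e 2| := matching_sum_top e 2.
  have -> : 'C(#|edges e|, 2)%:R - \sum_(i < n) 'C(deg e i, 2)%:R = #|matchings e 2|%:R :> R.
    by rewrite -(card_matchings2 e_sym e_irr) natrD natr_sum addrK.
  by rewrite /B /kz; ring.
rewrite cE; last by lia.
rewrite !big_ord_recl big_ord0 /= /bump /= type_sum0 // type_sum1 type_sum2 // ?tE; try lia.
rewrite type_sum3 // ?type_sum4 // ?type_sum5 // ?cycle_sum_top; try lia.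
under [X in _ = _ + X]eq_bigr => C _ do rewrite -mulrA.
rewrite -[X in _ = _ + X]mulr_suml.
set S := \sum_(C in _) _.
rewrite /B /kz; ring.
Qed.
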